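(* Let $\mathcal{G}$ be a finite alphabet with an involution $*$, and let $\mathcal{L}$ be a formal language over $\mathcal{G}$. Then the verbatim enumeration function $$f=\sum_{\omega\in\mathcal{L}}\omega$$ of $\mathcal{L}$ is matrix convex on $D_r$ for some $r>0$ if and only if $\mathcal{L}$ is Pythagorean.
   Context: An alphabet $\mathcal{G}$ is a set of formal symbols equipped with an involution $a \mapsto a^*$ (a map $\mathcal{G}\to\mathcal{G}$ with $(a^* )^*=a$). Symbols with $a=a^*$ are called self-adjoint and the others analytic. The involution extends to finite words by $(a_1a_2\cdots a_g)^* = a_g^*\cdots a_2^*a_1^*$. Products of words are concatenations. A formal language $\mathcal{L}$ is a set of finite words in $\mathcal{G}$. It is self-adjoint if $\omega\in\mathcal{L}$ implies $\omega^*\in\mathcal{L}$. A self-adjoint language $\mathcal{L}$ is called Pythagorean if for all nonempty words $\alpha,\beta,\gamma$ in $\mathcal{G}$, whenever $\beta^*\alpha\in\mathcal{L}$ and $\gamma^*\alpha\in\mathcal{L}$, also $\alpha^*\alpha\in\mathcal{L}$ and $\gamma^*\beta\in\mathcal{L}$. Evaluation: for $n\ge 1$, an admissible tuple of size $n$ is a family $A=(A_a)_{a\in\mathcal{G}}$ of complex $n\times n$ matrices with $A_{a^*}=(A_a)^*$ for all $a\in\mathcal{G}$ (so self-adjoint symbols receive self-adjoint matrices). For a word $\omega=a_1\cdots a_k$ put $A^\omega=A_{a_1}\cdots A_{a_k}$, with the empty word giving the identity. Put $f(A)=\sum_{\omega\in\mathcal{L}}A^\omega$. For $r>0$, $D_r$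 denotes the set of all admissible tuples $A$, of all sizes $n\ge1$, with $\|A\|=\max_{a\in\mathcal{G}}\|A_a\|\le r$ (operator norms). Matrix convexity: $f$ is matrix convex on $D_r$ if the series for $f$ converges absolutely and uniformly on $D_r$, $f(A)$ is self-adjoint for every $A\in D_r$, and $$f\left(\frac{A+B}{2}\right)\le\frac{f(A)+f(B)}{2}$$ for all $A,B\in D_r$ of the same size, where $E\le F$ means that $F-E$ is positive semidefinite. *)

(* Defs.v *)
From HB Require Import structures.
From mathcomp Require Import all_boot all_order all_algebra finmap.
From mathcomp Require Import complex.
From mathcomp Require Import summability.
From mathcomp Require Import all_classical all_reals all_analysis.

Set Implicit Arguments.
Unset Strict Implicit.
Unset Printing Implicit Defensive.

Import Order.TTheory GRing.Theory Num.Theory.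
Import numFieldNormedType.Exports.

Local Open Scope classical_set_scope.
Local Open Scope ring_scope.
Local Open Scope complex_scope.
Local Open Scope sesquilinear_scope.

Section Words.
Context (G : Type) (star : G -> G).

Definition word_star (w : seq G) : seq G := rev (map star w).

Definition selfadjoint_language (L : set (seq G)) : Prop :=
  forall w, L w -> L (word_star w).

Definition pythagorean (L : set (seq G)) : Prop :=
  selfadjoint_language L /\
  forall alpha beta gamma : seq G,
    alpha <> [::] -> beta <> [::] -> gamma <> [::] ->
    L (word_star beta ++ alpha) -> L (word_star gamma ++ alpha) ->
    L (word_star alpha ++ alpha) /\ L (word_star gamma ++ beta).

End Words.

Section Matrices.
Context (R : realType).

Definition vnorm n (v : 'cV[R[i]]_n) : R :=
  Num.sqrt (\sum_(i < n) ComplexField.Normc.normc (v i 0) ^+ 2).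

Definition opnorm n (M : 'M[R[i]]_n) : R :=
  sup [set vnorm (M *m v) | v in [set v | vnorm v <= 1]].

Definition psdmx n (M : 'M[R[i]]_n) : Prop :=
  M \is hermsymmx /\ forall v : 'cV[R[i]]_n, 0 <= (v ^t* *m M *m v) 0 0.

Definition loewner_le n (E F : 'M[R[i]]_n) : Prop := psdmx (F - E).

End Matrices.

(* A size n >= 1 is written n.+1, so that square matrices form a nonzero ring. *)
Section Evaluation.
Context (R : realType) (G : finType) (star : G -> G) (L : set (seq G)).

Definition admissible n (A : G -> 'M[R[i]]_n.+1) : Prop :=
  forall a, A (star a) = (A a) ^t*.

Definition tuple_norm n (A : G -> 'M[R[i]]_n.+1) : R :=
  \big[Num.max/0]_(a : G) opnorm (A a).

Definition nc_ball (r : R) n : set (G -> 'M[R[i]]_n.+1) :=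
  [set A | admissible A /\ tuple_norm A <= r].

Definition word_eval n (A : G -> 'M[R[i]]_n.+1) (w : seq G) : 'M[R[i]]_n.+1 :=
  \prod_(a <- w) A a.

Definition enum_partial n (A : G -> 'M[R[i]]_n.+1) (F : {fset seq G}) :
    'M[R[i]]_n.+1 :=
  \sum_(w <- F | w \in L) word_eval A w.

(* Unordered sum over L. The topology on matrices comes from that of the
   complex numbers, which the library attaches to the alias R[i]^o. *)
Definition enum_fun n (A : G -> 'M[R[i]]_n.+1) : 'M[R[i]]_n.+1 :=
  lim ((enum_partial A : _ -> 'M[R[i]^o]_n.+1) @ totally).

Definition abs_convergent_on (r : R) : Prop :=
  forall n (A : G -> 'M[R[i]]_n.+1), nc_ball r A ->
    summable L (fun w => (opnorm (word_eval A w))%:E).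

(* The index set F is chosen uniformly over tuples of all sizes. The bound
   also forces the limit defining [enum_fun] to exist at each tuple. *)
Definition unif_convergent_on (r : R) : Prop :=
  forall eps : R, 0 < eps ->
    \forall F \near totally, forall n (A : G -> 'M[R[i]]_n.+1), nc_ball r A ->
      opnorm (enum_partial A F - enum_fun A) < eps.

Definition matrix_convex (r : R) : Prop :=
  [/\ abs_convergent_on r,
      unif_convergent_on r,
      forall n (A : G -> 'M[R[i]]_n.+1), nc_ball r A ->
        enum_fun A \is hermsymmx
    & forall n (A B : G -> 'M[R[i]]_n.+1), nc_ball r A -> nc_ball r B ->
        loewner_le (enum_fun (fun a => 2^-1 *: (A a + B a)))
                   (2^-1 *: (enum_fun A + enum_fun B))].

End Evaluation.

(* Main.v *)
Require Import Defs.
From HB Require Import structures.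
From mathcomp Require Import all_boot all_order all_algebra finmap.
From mathcomp Require Import complex summability ring lra zify.
From mathcomp Require Import all_classical all_reals all_analysis.

(* Write [u ~ w] when [u^* w] lies in L (u, w nonempty words).  Being Pythagorean
   amounts to L being self-adjoint and [~] being a partial equivalence relation, that
   is, the 0/1 kernel [K(u, w) = [u ~ w]] being positive semidefinite.

   Pythagorean => convex.  A letter c acts as a partial injection on the classes
   of [~], with partial inverse c^*, so f is an affine function plus
   [Lambda^* (1 - Gamma)^-1 Lambda], Gamma and Lambda linear in A and Gamma a
   contraction on small balls.  The quadratic form of the second term at v is the
   maximum over y of [2 Re <y, Lambda v> - <y, (1 - Gamma) y>], which is affine in A
   for fixed y; the maximiser has coordinates [A^u v].  The state space may be
   infinite, hence the argument is carried out on words of length at most N, with an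
   error [(#|G| r)^N].

   Convex => Pythagorean.  Tuples of small matrices indexed by words s (edges
   [s -- a s] of weight t) and one extra vertex, joined to s by an edge of letter a and
   weight [x(a s) t^(m+1-|s|)], make every walk weigh t to the total variation of
   the height.  The leading coefficient of [f] detects membership of a word, and
   that of the second difference at x, 0, -x is the quadratic form of K at x. *)

Set Implicit Arguments.
Unset Strict Implicit.
Unset Printing Implicit Defensive.

Import Order.TTheory GRing.Theory Num.Theory.
Import numFieldNormedType.Exports.

Local Open Scope classical_set_scope.
Local Open Scope ring_scope.
Local Open Scope complex_scope.
Local Open Scope sesquilinear_scope.

#[local] Existing Instance totally_filter.

Local Notation normc := ComplexField.Normc.normc.
Local Notation cRe := complex.Re.

(** * Real inner product and operator norm *)

Section RealInnerProduct.
Context (R : realType).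
Implicit Types (x y : R[i]) (a : R).

Lemma conjCE x : Num.conj x = conjc x. Proof. by []. Qed.

Lemma ReD x y : cRe (x + y) = cRe x + cRe y.
Proof. by case: x; case: y. Qed.

Lemma ReN x : cRe (- x) = - cRe x.
Proof. by case: x. Qed.

Lemma Re_sum (I : Type) (s : seq I) (P : pred I) (F : I -> R[i]) :
  cRe (\sum_(i <- s | P i) F i) = \sum_(i <- s | P i) cRe (F i).
Proof. by apply: (big_morph (@complex.Re R)) => // x y; exact: ReD. Qed.

Lemma Re_realM a x : cRe (a%:C * x) = a * cRe x.
Proof. by case: x => c d /=; rewrite mul0r subr0. Qed.

Lemma normc_ge0 x : 0 <= normc x.
Proof. by case: x => a b; exact: sqrtr_ge0. Qed.

Lemma normc_real a : normc a%:C = `|a|.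
Proof. by rewrite /= expr0n addr0 sqrtr_sqr. Qed.

Lemma normcD x y : normc (x + y) <= normc x + normc y.
Proof. exact: le_normcD. Qed.

Lemma normc_sum (I : Type) (s : seq I) (P : pred I) (F : I -> R[i]) :
  normc (\sum_(i <- s | P i) F i) <= \sum_(i <- s | P i) normc (F i).
Proof.
elim/big_rec2: _ => [|i y1 y2 _ h]; first by rewrite ComplexField.Normc.normc0.
by apply: le_trans (normcD _ _) _; rewrite lerD2l.
Qed.

Lemma normc_conj x : normc (conjc x) = normc x.
Proof. by case: x => a b /=; rewrite sqrrN. Qed.

Lemma Re_conjM x : cRe (Num.conj x * x) = normc x ^+ 2.
Proof.
rewrite conjCE; case: x => a b /=.
by rewrite sqr_sqrtr ?addr_ge0 ?sqr_ge0// mulNr opprK -!expr2.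
Qed.

(** Only the real part of the Hermitian inner product is kept: it is symmetric and bilinear over
    [R], and it suffices to test positivity of Hermitian matrices. *)
Definition rdot n (u v : 'cV[R[i]]_n) : R := cRe ((u ^t* *m v) 0 0).

Lemma rdotE n (u v : 'cV[R[i]]_n) :
  rdot u v = \sum_i cRe (Num.conj (u i 0) * v i 0).
Proof.
by rewrite /rdot !mxE Re_sum; apply: eq_bigr => i _; rewrite !mxE.
Qed.

Lemma rdotC n (u v : 'cV[R[i]]_n) : rdot u v = rdot v u.
Proof.
rewrite !rdotE; apply: eq_bigr => i _; rewrite !conjCE.
by case: (u i 0) (v i 0) => [a b] [c d] /=; ring.
Qed.

Lemma rdotDr n (u v w : 'cV[R[i]]_n) : rdot u (v + w) = rdot u v + rdot u w.
Proof. by rewrite /rdot mulmxDr mxE ReD. Qed.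

Lemma rdotDl n (u v w : 'cV[R[i]]_n) : rdot (u + v) w = rdot u w + rdot v w.
Proof. by rewrite rdotC rdotDr !(rdotC w). Qed.

Lemma rdotNr n (u v : 'cV[R[i]]_n) : rdot u (- v) = - rdot u v.
Proof. by rewrite /rdot mulmxN mxE ReN. Qed.

Lemma rdotNl n (u v : 'cV[R[i]]_n) : rdot (- u) v = - rdot u v.
Proof. by rewrite rdotC rdotNr rdotC. Qed.

Lemma rdotBr n (u v w : 'cV[R[i]]_n) : rdot u (v - w) = rdot u v - rdot u w.
Proof. by rewrite rdotDr rdotNr. Qed.

Lemma rdotBl n (u v w : 'cV[R[i]]_n) : rdot (u - v) w = rdot u w - rdot v w.
Proof. by rewrite rdotDl rdotNl. Qed.

Lemma rdot0r n (u : 'cV[R[i]]_n) : rdot u 0 = 0.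
Proof. by rewrite /rdot mulmx0 mxE. Qed.

Lemma rdotZr n a (u v : 'cV[R[i]]_n) : rdot u (a%:C *: v) = a * rdot u v.
Proof. by rewrite /rdot -scalemxAr mxE Re_realM. Qed.

Lemma rdotZl n a (u v : 'cV[R[i]]_n) : rdot (a%:C *: u) v = a * rdot u v.
Proof. by rewrite rdotC rdotZr rdotC. Qed.

Lemma rdot_sumr n (I : Type) (s : seq I) (P : pred I) (u : 'cV[R[i]]_n)
    (F : I -> 'cV[R[i]]_n) :
  rdot u (\sum_(i <- s | P i) F i) = \sum_(i <- s | P i) rdot u (F i).
Proof.
apply: (big_morph (rdot u)) => [x y|]; [exact: rdotDr | exact: rdot0r].
Qed.

Lemma rdot_suml n (I : Type) (s : seq I) (P : pred I) (u : 'cV[R[i]]_n)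
    (F : I -> 'cV[R[i]]_n) :
  rdot (\sum_(i <- s | P i) F i) u = \sum_(i <- s | P i) rdot (F i) u.
Proof. by rewrite rdotC rdot_sumr; apply: eq_bigr => i _; exact: rdotC. Qed.

Lemma adjmxM m n p (M : 'M[R[i]]_(m, n)) (N : 'M[R[i]]_(n, p)) :
  (M *m N) ^t* = N ^t* *m M ^t*.
Proof. by rewrite trmx_mul map_mxM. Qed.

Lemma adjmxK m n (M : 'M[R[i]]_(m, n)) : (M ^t*) ^t* = M.
Proof. by apply/matrixP => i j; rewrite !mxE conjCK. Qed.

Lemma rdot_adj n (M : 'M[R[i]]_n) (u v : 'cV[R[i]]_n) :
  rdot u (M *m v) = rdot (M ^t* *m u) v.
Proof. by rewrite /rdot adjmxM adjmxK mulmxA. Qed.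

Lemma rdot_ge0 n (u : 'cV[R[i]]_n) : 0 <= rdot u u.
Proof.
by rewrite rdotE sumr_ge0// => i _; rewrite Re_conjM sqr_ge0.
Qed.

Lemma vnormE n (v : 'cV[R[i]]_n) : vnorm v = Num.sqrt (rdot v v).
Proof.
by rewrite rdotE; congr Num.sqrt; apply: eq_bigr => i _; rewrite Re_conjM.
Qed.

Lemma vnorm_ge0 n (v : 'cV[R[i]]_n) : 0 <= vnorm v.
Proof. exact: sqrtr_ge0. Qed.

Lemma sqr_vnorm n (v : 'cV[R[i]]_n) : vnorm v ^+ 2 = rdot v v.
Proof. by rewrite vnormE sqr_sqrtr// rdot_ge0. Qed.

Lemma vnorm0 n : vnorm (0 : 'cV[R[i]]_n) = 0.
Proof. by rewrite vnormE rdot0r sqrtr0. Qed.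

(** Cauchy-Schwarz, from the nonnegativity of |a u - b v|^2 at a = |v|, b = |u|, once neither norm
    vanishes. *)
Lemma rdot_le n (u v : 'cV[R[i]]_n) : rdot u v <= vnorm u * vnorm v.
Proof.
set p := vnorm u; set q := vnorm v.
have p0 : 0 <= p := vnorm_ge0 u; have q0 : 0 <= q := vnorm_ge0 v.
have h (a b : R) : 0 <= a ^+ 2 * p ^+ 2 - 2 * a * b * rdot u v + b ^+ 2 * q ^+ 2.
  have := rdot_ge0 (a%:C *: u - b%:C *: v).
  rewrite rdotBr !rdotBl !rdotZr !rdotZl (rdotC v u) -!sqr_vnorm -/p -/q.
  by congr (_ <= _); ring.
have [p1|p1] := eqVneq p 0.
  rewrite p1 mul0r leNgt; apply/negP => r0.
  (* With |u| = 0 the expression in [h] is b^2 q^2 - 2 a b <u, v>; at these values it equals q^2 - 2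
     (q^2 + 1) < 0. *)
  have := h ((q ^+ 2 + 1) / rdot u v) 1; rewrite p1.
  rewrite mulr1 -(mulrA 2) divfK ?gt_eqF//; nra.
have [q1|q1] := eqVneq q 0.
  rewrite q1 mulr0 leNgt; apply/negP => r0.
  have := h 1 ((p ^+ 2 + 1) / rdot u v); rewrite q1.
  rewrite mulr1 -(mulrA 2) divfK ?gt_eqF//; nra.
have pq0 : 0 < 2 * (q * p) by rewrite !mulr_gt0// lt_def ?p1 ?q1.
rewrite -(ler_pM2l pq0).
have := h q p; nra.
Qed.

Lemma vnormN n (v : 'cV[R[i]]_n) : vnorm (- v) = vnorm v.
Proof. by rewrite !vnormE rdotNr rdotNl opprK. Qed.

Lemma rdot_abs_le n (u v : 'cV[R[i]]_n) : `|rdot u v| <= vnorm u * vnorm v.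
Proof. by rewrite ler_norml lerNl -rdotNr -{1}(vnormN v) !rdot_le. Qed.

Lemma vnormD n (u v : 'cV[R[i]]_n) : vnorm (u + v) <= vnorm u + vnorm v.
Proof.
rewrite -(@ler_pXn2r _ 2)// ?nnegrE ?addr_ge0 ?vnorm_ge0//.
rewrite sqr_vnorm rdotDr !rdotDl (rdotC v u) sqrrD -!sqr_vnorm.
have := rdot_le u v; lra.
Qed.

Lemma vnorm_sum n (I : Type) (s : seq I) (P : pred I) (F : I -> 'cV[R[i]]_n) :
  vnorm (\sum_(i <- s | P i) F i) <= \sum_(i <- s | P i) vnorm (F i).
Proof.
elim/big_rec2: _ => [|i y1 y2 _ h]; first by rewrite vnorm0.
by apply: le_trans (vnormD _ _) _; rewrite lerD2l.
Qed.

Lemma vnormZ n (x : R[i]) (v : 'cV[R[i]]_n) : vnorm (x *: v) = normc x * vnorm v.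
Proof.
apply/eqP; rewrite -(@eqrXn2 _ 2)// ?mulr_ge0 ?vnorm_ge0 ?normc_ge0//.
rewrite exprMn !sqr_vnorm !rdotE mulr_sumr; apply/eqP; apply: eq_bigr => i _.
by rewrite !mxE !Re_conjM ComplexField.Normc.normcM exprMn.
Qed.

Lemma vnorm_entry n (v : 'cV[R[i]]_n) i : normc (v i 0) <= vnorm v.
Proof.
rewrite -(@ler_pXn2r _ 2)// ?nnegrE ?vnorm_ge0 ?normc_ge0//.
rewrite sqr_vnorm rdotE (bigD1 i)//= Re_conjM lerDl.
by apply: sumr_ge0 => j _; rewrite Re_conjM sqr_ge0.
Qed.

Lemma vnorm_delta n (i : 'I_n) : vnorm (delta_mx i 0 : 'cV[R[i]]_n) = 1.
Proof.
rewrite vnormE rdotE (bigD1 i)//= Re_conjM !mxE !eqxx.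
rewrite ComplexField.Normc.normc1 expr1n big1 ?addr0 ?sqrtr1// => j ji.
by rewrite Re_conjM !mxE (negPf ji) /= expr0n /= addr0 sqrtr0 expr0n.
Qed.

Lemma vnorm_le_sum n (v : 'cV[R[i]]_n) : vnorm v <= \sum_i normc (v i 0).
Proof.
have -> : v = \sum_i v i 0 *: delta_mx i 0.
  by rewrite {1}[v]matrix_sum_delta; apply: eq_bigr => i _; rewrite big_ord1.
apply: le_trans (vnorm_sum _ _ _) _; apply: ler_sum => i _.
rewrite vnormZ vnorm_delta mulr1 summxE (bigD1 i)//= big1.
  by rewrite !mxE !eqxx addr0 mulr1.
by move=> j ji; rewrite !mxE eq_sym (negPf ji) mulr0.
Qed.

(** A crude entrywise bound, which shows that the set defining [opnorm] is bounded above, so that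
    its supremum is meaningful. *)
Lemma vnorm_mul_le_sum m (M : 'M[R[i]]_m) (v : 'cV[R[i]]_m) :
  vnorm (M *m v) <= (\sum_i \sum_j normc (M i j)) * vnorm v.
Proof.
apply: le_trans (vnorm_le_sum _) _; rewrite mulr_suml; apply: ler_sum => i _.
rewrite mxE mulr_suml; apply: le_trans (normc_sum _ _ _) _.
apply: ler_sum => j _; rewrite ComplexField.Normc.normcM.
by rewrite ler_wpM2l ?normc_ge0// vnorm_entry.
Qed.

Local Notation opset M := [set vnorm (M *m v) | v in [set v | vnorm v <= 1]].

Lemma opset_nonempty n (M : 'M[R[i]]_n) : opset M !=set0.
Proof. by exists (vnorm (M *m 0)), 0 => //=; rewrite vnorm0 ler01. Qed.

Lemma opset_has_sup n (M : 'M[R[i]]_n) : has_sup (opset M).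
Proof.
split; first exact: opset_nonempty.
exists (\sum_i \sum_j normc (M i j)) => _ [v /= v1 <-].
apply: le_trans (vnorm_mul_le_sum _ _) _; rewrite ler_piMr//.
by do 2![apply: sumr_ge0 => ? _]; exact: normc_ge0.
Qed.

Lemma opnorm_le n (M : 'M[R[i]]_n) (c : R) :
  (forall v, vnorm v <= 1 -> vnorm (M *m v) <= c) -> opnorm M <= c.
Proof.
move=> h; apply: ge_sup; first exact: opset_nonempty.
by move=> _ [v /= v1 <-]; exact: h.
Qed.

Lemma opnorm_ge0 n (M : 'M[R[i]]_n) : 0 <= opnorm M.
Proof.
apply: le_trans (vnorm_ge0 (M *m 0)) _; apply: ub_le_sup.
  by case: (opset_has_sup M).
by exists 0 => //=; rewrite vnorm0 ler01.
Qed.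

Lemma vnorm_mul n (M : 'M[R[i]]_n) (v : 'cV[R[i]]_n) :
  vnorm (M *m v) <= opnorm M * vnorm v.
Proof.
have [v0|v0] := eqVneq (vnorm v) 0.
  by have := vnorm_mul_le_sum M v; rewrite v0 !mulr0.
have vp : 0 < vnorm v by rewrite lt_def v0 vnorm_ge0.
rewrite -ler_pdivrMr//.
have vi : 0 <= (vnorm v)^-1 by rewrite invr_ge0 ltW.
have -> : vnorm (M *m v) / vnorm v = vnorm (M *m ((vnorm v)^-1%:C *: v)).
  by rewrite -scalemxAr vnormZ normc_real ger0_norm// mulrC.
apply: ub_le_sup; first by case: (opset_has_sup M).
exists ((vnorm v)^-1%:C *: v) => //=.
by rewrite vnormZ normc_real ger0_norm// mulVf.
Qed.

Lemma opnormM n (M N : 'M[R[i]]_n) : opnorm (M *m N) <= opnorm M * opnorm N.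
Proof.
apply: opnorm_le => v v1; rewrite -mulmxA.
apply: le_trans (vnorm_mul _ _) _; rewrite ler_wpM2l ?opnorm_ge0//.
by apply: le_trans (vnorm_mul _ _) _; rewrite ler_piMr ?opnorm_ge0.
Qed.

Lemma opnormD n (M N : 'M[R[i]]_n) : opnorm (M + N) <= opnorm M + opnorm N.
Proof.
apply: opnorm_le => v v1; rewrite mulmxDl.
apply: le_trans (vnormD _ _) _; apply: lerD;
  by apply: le_trans (vnorm_mul _ _) _; rewrite ler_piMr ?opnorm_ge0.
Qed.

Lemma opnorm_sum n (I : Type) (s : seq I) (P : pred I) (F : I -> 'M[R[i]]_n) :
  opnorm (\sum_(i <- s | P i) F i) <= \sum_(i <- s | P i) opnorm (F i).
Proof.
elim/big_rec2: _ => [|i y1 y2 _ h].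
  by apply: opnorm_le => v _; rewrite mul0mx vnorm0.
by apply: le_trans (opnormD _ _) _; rewrite lerD2l.
Qed.

Lemma opnormZ_real n a (M : 'M[R[i]]_n) : opnorm (a%:C *: M) <= `|a| * opnorm M.
Proof.
apply: opnorm_le => v v1; rewrite -scalemxAl vnormZ normc_real.
rewrite ler_wpM2l//.
by apply: le_trans (vnorm_mul _ _) _; rewrite ler_piMr ?opnorm_ge0.
Qed.

Lemma opnorm1 n : opnorm (1%:M : 'M[R[i]]_n) <= 1.
Proof. by apply: opnorm_le => v; rewrite mul1mx. Qed.

Lemma normc_entry_le n (M : 'M[R[i]]_n) i j : normc (M i j) <= opnorm M.
Proof.
have -> : M i j = (M *m delta_mx j 0 : 'cV_n) i 0.
  rewrite mxE (bigD1 j)//= big1 ?mxE ?eqxx ?mulr1 ?addr0// => k kj.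
  by rewrite mxE (negPf kj) mulr0.
apply: le_trans (vnorm_entry _ _) _.
by apply: le_trans (vnorm_mul _ _) _; rewrite vnorm_delta mulr1.
Qed.

Lemma opnorm_le_sum n (M : 'M[R[i]]_n) : opnorm M <= \sum_i \sum_j normc (M i j).
Proof.
apply: opnorm_le => v v1; apply: le_trans (vnorm_mul_le_sum _ _) _.
by rewrite ler_piMr//; do 2![apply: sumr_ge0 => ? _]; exact: normc_ge0.
Qed.

Lemma hermsymmxP n (M : 'M[R[i]]_n) :
  reflect (M = M ^t*) (M \is hermsymmx).
Proof. by apply: (iffP (is_hermitianmxP _ _ _)); rewrite expr0 scale1r. Qed.

(** The order of [R[i]] requires the imaginary part to vanish. For Hermitian M the number v^* M v is
    its own conjugate, so only its real part has to be tested. *)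
Lemma psdmxP n (M : 'M[R[i]]_n) :
  psdmx M <-> M = M ^t* /\ forall v, 0 <= rdot v (M *m v).
Proof.
split=> [[/hermsymmxP h p]|[h p]].
  split=> // v.
  by have := p v; rewrite lecE /= => /andP[_]; rewrite /rdot mulmxA.
split=> [|v]; first exact/hermsymmxP.
rewrite lecE /= -mulmxA; apply/andP; split; last exact: p.
set x := (_ *m _) 0 0.
have : conjc x = x.
  rewrite /x; have -> : conjc ((v ^t* *m (M *m v)) 0 0) =
      ((v ^t* *m (M *m v)) ^t*) 0 0 by rewrite [RHS]mxE [in RHS]mxE.
  by rewrite !adjmxM adjmxK -h mulmxA.
by case: (x) => a b [] /= /eqP; rewrite eq_sym -addr_eq0 -mulr2n mulrn_eq0.
Qed.

End RealInnerProduct.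

(** * Words *)

Section WordStar.
Context (G : Type) (star : G -> G).
Implicit Types u w : seq G.

Lemma word_star_cat u w :
  word_star star (u ++ w) = word_star star w ++ word_star star u.
Proof. by rewrite /word_star map_cat rev_cat. Qed.

Lemma word_star_cons a w :
  word_star star (a :: w) = rcons (word_star star w) (star a).
Proof. by rewrite /word_star /= rev_cons. Qed.

Lemma size_word_star w : size (word_star star w) = size w.
Proof. by rewrite size_rev size_map. Qed.

Lemma word_starK : involutive star -> involutive (word_star star).
Proof. by move=> sK w; rewrite /word_star map_rev revK mapK. Qed.

End WordStar.

(** * Enumeration of words by length and geometric bounds *)

Section Enumeration.
Context (G : finType).
Implicit Types (s w : seq G) (k N : nat).

Fixpoint words k : seq (seq G) :=
  if k is k'.+1 then [seq a :: w | a <- enum G, w <- words k'] else [:: [::]].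

Lemma mem_words k w : (w \in words k) = (size w == k).
Proof.
elim: k w => [|k IH] [|a w] //=; first by apply/allpairsP => -[[]] ? ? [].
rewrite eqSS -IH; apply/allpairsP/idP => [[[b u] /= [_ hu [_ ->]]]//|wk].
by exists (a, w); rewrite mem_enum.
Qed.

Lemma words_uniq k : uniq (words k).
Proof.
elim: k => //= k IH; apply: allpairs_uniq => //; first exact: enum_uniq.
by move=> [a u] [b w] _ _ /= [-> ->].
Qed.

Lemma big_words_cons (V : nmodType) k (F : seq G -> V) :
  \sum_(w <- words k.+1) F w = \sum_(w <- words k) \sum_a F (a :: w).
Proof. by rewrite /= big_allpairs_dep /= big_enum /= exchange_big. Qed.

Definition words_between (m n : nat) : seq (seq G) :=
  flatten [seq words k | k <- index_iota m n].

Lemma mem_words_between m n w : (w \in words_between m n) = (m <= size w < n)%N.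
Proof.
apply/flattenP/idP => [[_ /mapP[k + ->]]|h].
  by rewrite mem_index_iota mem_words => + /eqP ->.
by exists (words (size w)); rewrite ?mem_words// map_f// mem_index_iota.
Qed.

Lemma big_words_between (V : nmodType) m n (F : seq G -> V) :
  \sum_(w <- words_between m n) F w = \sum_(m <= k < n) \sum_(w <- words k) F w.
Proof. by rewrite big_flatten /= big_map. Qed.

Lemma words_between_uniq m n : uniq (words_between m n).
Proof.
have := iota_uniq m (n - m); rewrite /words_between -/(index_iota m n).
elim: (index_iota m n) => //= k s IH /andP[ks us]; rewrite cat_uniq words_uniq IH// andbT.
apply/hasPn => w /flattenP[_ /mapP[j js ->]]; rewrite /= !mem_words => /eqP ->.
by apply: contra ks => /eqP <-.
Qed.

(** Prefixing a letter turns the lengths 1..N into 2..N+1. The one-letter words fill the gap at the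
    bottom, and the words of length N + 1 are the overflow. *)
Lemma big_words_between_shift (V : nmodType) N (F : seq G -> V) :
  \sum_a F [:: a] + \sum_(w <- words_between 1 N.+1) \sum_a F (a :: w) =
  \sum_(w <- words_between 1 N.+1) F w + \sum_(w <- words N.+1) F w.
Proof.
rewrite !big_words_between.
have -> : \sum_(1 <= k < N.+1) \sum_(w <- words k) \sum_a F (a :: w) =
    \sum_(1 <= k < N.+1) \sum_(w <- words k.+1) F w.
  by apply: eq_bigr => k _; rewrite big_words_cons.
have -> : \sum_a F [:: a] = \sum_(w <- words 1) F w.
  by rewrite big_words_cons big_seq1.
rewrite -(big_nat_recr _ _ (fun k => \sum_(w <- words k) F w))//.
by rewrite big_nat_recl//= big_add1.
Qed.

(* Every word of length k + 1 is u^* b for a unique word u of length k and letter b. *)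
Lemma big_words_star_rcons (star : G -> G) (V : nmodType) k (F : seq G -> V) :
  involutive star ->
  \sum_(w <- words k.+1) F w =
  \sum_(u <- words k) \sum_b F (rcons (word_star star u) b).
Proof.
move=> sK; rewrite exchange_big.
have -> : \sum_b \sum_(u <- words k) F (rcons (word_star star u) b) =
    \sum_(w <- [seq rcons (word_star star u) b | b <- enum G, u <- words k]) F w.
  by rewrite big_allpairs_dep /= big_enum.
apply: perm_big; apply: uniq_perm; first exact: words_uniq.
  apply: allpairs_uniq; rewrite ?enum_uniq ?words_uniq//.
  move=> [a u] [b w] _ _ /= /rcons_inj[/(congr1 (word_star star))].
  by rewrite !word_starK// => -> ->.
move=> w; rewrite mem_words; apply/idP/allpairsP.
  case/lastP: w => [//|w b]; rewrite size_rcons eqSS => /eqP sw.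
  exists (b, word_star star w); rewrite mem_enum mem_words size_word_star sw eqxx.
  by rewrite /= word_starK.
by move=> [[b u] /= [_]]; rewrite mem_words => /eqP <- ->; rewrite size_rcons size_word_star.
Qed.

Context (R : realType).
Implicit Types (x : R).

Lemma ler_big_subset (I : eqType) (s t : seq I) (F : I -> R) :
  uniq s -> uniq t -> {subset s <= t} -> (forall i, 0 <= F i) ->
  \sum_(i <- s) F i <= \sum_(i <- t) F i.
Proof.
move=> us ut st F0; rewrite [leRHS](bigID (mem s))/=.
have -> : \sum_(i <- t | i \in s) F i = \sum_(i <- s) F i.
  rewrite -big_filter; apply: perm_big; apply: uniq_perm => //.
    exact: filter_uniq.
  by move=> i; rewrite mem_filter; case: (boolP (i \in s)) => // /st.
by rewrite lerDl sumr_ge0.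
Qed.

Lemma sum_words_expr k x : \sum_(w <- words k) x ^+ size w = (#|G|%:R * x) ^+ k.
Proof.
elim: k => [|k IH]; first by rewrite big_seq1.
rewrite big_words_cons exprS -IH mulr_sumr; apply: eq_bigr => w _ /=.
by rewrite sumr_const exprS mulr_natl mulrnAl.
Qed.

Lemma sum_geometric_le N n x : 0 <= x <= 2^-1 ->
  \sum_(N <= k < n) x ^+ k <= 2 * x ^+ N.
Proof.
move=> /andP[x0 x1]; have [nN|/ltnW Nn] := leqP n N.
  by rewrite big_geq// mulr_ge0// exprn_ge0.
(* The induction needs the sharper bound; its step is x^n <= 2 x^n - 2 x^(n+1), that is, x <=
   1/2. *)
suff : \sum_(N <= k < n) x ^+ k <= 2 * x ^+ N - 2 * x ^+ n.
  by move=> /le_trans; apply; rewrite gerBl mulr_ge0// exprn_ge0.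
elim: n Nn => [|n IH]; first by rewrite leqn0 => /eqP ->; rewrite big_geq// subrr.
rewrite leq_eqVlt => /predU1P[->|]; first by rewrite big_geq// subrr.
rewrite ltnS => Nn; rewrite big_nat_recr//= exprS.
have := IH Nn; have : 0 <= x ^+ n by rewrite exprn_ge0.
nra.
Qed.

(** There are #|G|^k words of length k, so the sum is dominated by a geometric series of ratio #|G|
    x starting at exponent N. *)
Lemma sum_long_words_le N x (s : seq (seq G)) :
  0 <= x -> #|G|%:R * x <= 2^-1 -> uniq s ->
  (forall w, w \in s -> (N <= size w)%N) ->
  \sum_(w <- s) x ^+ size w <= 2 * (#|G|%:R * x) ^+ N.
Proof.
move=> x0 gx us sN.
pose n := (\max_(w <- s) size w).+1.
apply: (@le_trans _ _ (\sum_(w <- words_between N n) x ^+ size w)).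
  apply: ler_big_subset => //; first exact: words_between_uniq.
    move=> w ws; rewrite mem_words_between sN//= ltnS.
    by rewrite (big_rem w)//= leq_maxl.
  by move=> w; exact: exprn_ge0.
rewrite big_words_between; under eq_bigr do rewrite sum_words_expr.
by apply: sum_geometric_le; rewrite mulr_ge0.
Qed.

Lemma sum_long_words_half_le N x (s : seq (seq G)) :
  0 <= x -> #|G|%:R * x <= 2^-1 -> uniq s ->
  (forall w, w \in s -> (N <= size w)%N) ->
  \sum_(w <- s) x ^+ size w <= 2 * 2^-1 ^+ N.
Proof.
move=> x0 gx us sN; apply: le_trans (sum_long_words_le x0 gx us sN) _.
by rewrite ler_pM2l// lerXn2r ?nnegrE ?mulr_ge0.
Qed.

End Enumeration.

(** * Evaluation of words on tuples of matrices *)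

Section WordEval.
Context (R : realType) (G : finType) (star : G -> G).
Variable n : nat.
Implicit Types (A : G -> 'M[R[i]]_n.+1) (w : seq G).

Lemma word_eval_nil A : word_eval A [::] = 1%:M.
Proof. exact: big_nil. Qed.

Lemma word_eval_cons A a w : word_eval A (a :: w) = A a *m word_eval A w.
Proof. exact: big_cons. Qed.

Lemma word_eval_cat A u w : word_eval A (u ++ w) = word_eval A u *m word_eval A w.
Proof. exact: big_cat. Qed.

Lemma word_eval_star A w : admissible star A ->
  word_eval A (word_star star w) = (word_eval A w) ^t*.
Proof.
move=> hA; elim: w => [|a w IH].
  by rewrite !word_eval_nil trmx1 map_mx1.
rewrite word_star_cons -cats1 word_eval_cat IH !word_eval_cons word_eval_nil.
by rewrite mulmx1 hA adjmxM.
Qed.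

Lemma nc_ball_letter r A a : nc_ball star r A -> opnorm (A a) <= r.
Proof. by move=> [_]; apply: le_trans; apply: (le_bigmax _ (fun a => opnorm (A a))). Qed.

Lemma opnorm_word_eval r A w : (forall a, opnorm (A a) <= r) ->
  opnorm (word_eval A w) <= r ^+ size w.
Proof.
move=> hA; elim: w => [|a w IH]; first by rewrite word_eval_nil opnorm1.
rewrite word_eval_cons exprS; apply: le_trans (opnormM _ _) _.
by apply: ler_pM => //; exact: opnorm_ge0.
Qed.

Lemma vnorm_word_eval r A w v : (forall a, opnorm (A a) <= r) ->
  vnorm (word_eval A w *m v) <= r ^+ size w * vnorm v.
Proof.
move=> hA; apply: le_trans (vnorm_mul _ _) _.
by rewrite ler_wpM2r ?vnorm_ge0 ?opnorm_word_eval.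
Qed.

Lemma nc_ball_midpoint r A B : nc_ball star r A -> nc_ball star r B -> 0 <= r ->
  nc_ball star r (fun a => 2^-1 *: (A a + B a)).
Proof.
have e : 2^-1 = (2^-1)%:C :> R[i] by rewrite fmorphV rmorph_nat.
have ec : Num.conj (2^-1 : R[i]) = 2^-1 by rewrite {1}e conjCE conjc_real -e.
move=> hA hB r0; split=> [a|].
  rewrite (hA.1 a) (hB.1 a); apply/matrixP => i j; rewrite !mxE.
  by rewrite rmorphM rmorphD/= ec.
apply/bigmax_leP; split=> // a _; rewrite e.
apply: le_trans (opnormZ_real _ _) _; rewrite ger0_norm ?invr_ge0//.
rewrite ler_pdivrMl//; apply: le_trans (opnormD _ _) _.
have := nc_ball_letter a hA; have := nc_ball_letter a hB; lra.
Qed.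

End WordEval.

(** * Pythagorean languages: truncated convexity *)

Section Kernel.
Context (G : finType) (star : G -> G) (starK : involutive star).
Context (L : set (seq G)).
Implicit Types (u w s t : seq G).

Definition wker u w : bool := word_star star u ++ w \in L.

(** Adjointness: a letter in front of w moves, starred, in front of u. This is why c^* inverts c on
    the classes. *)
Lemma wker_cons u c w : wker u (c :: w) = wker (star c :: u) w.
Proof. by rewrite /wker word_star_cons starK cat_rcons. Qed.

Lemma selfadjoint_mem : selfadjoint_language star L ->
  forall w, (word_star star w \in L) = (w \in L).
Proof.
move=> hL w; apply/idP/idP; rewrite !inE => /hL //.
by rewrite word_starK.
Qed.

Hypothesis pyth : pythagorean star L.

Lemma wkerC u w : wker u w = wker w u.
Proof.
rewrite /wker -(selfadjoint_mem pyth.1) word_star_cat word_starK//.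
Qed.

(** The Pythagorean condition with beta = gamma = u and alpha = w. *)
Lemma wker_refl u w : u != [::] -> w != [::] -> wker u w -> wker w w.
Proof.
move=> /eqP u0 /eqP w0; rewrite /wker !inE => uw.
by case: (pyth.2 w u u).
Qed.

Lemma wker_trans t u w : t != [::] -> u != [::] -> w != [::] ->
  wker u t -> wker t w -> wker u w.
Proof.
move=> /eqP t0 /eqP u0 /eqP w0; rewrite (wkerC t) /wker !inE => ut wt.
by have [_] := pyth.2 t w u t0 w0 u0 wt ut.
Qed.

(** A canonical representative of the class of u, meaningful when [u ~ u]: [choose] depends only on
    the predicate, which is the same for all members of the class. *)
Definition lrep u : seq G := choose [pred w | (w != [::]) && wker u w] u.

Lemma lrepP u : u != [::] -> wker u u -> lrep u != [::] /\ wker u (lrep u).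
Proof.
move=> u0 uu; apply/andP.
by apply: (@chooseP _ [pred w | (w != [::]) && wker u w]); rewrite /= u0.
Qed.

Lemma lrep_eq u w : u != [::] -> w != [::] -> wker u u -> wker w w ->
  (lrep u == lrep w) = wker u w.
Proof.
move=> u0 w0 uu ww; apply/eqP/idP => [e|uw].
  have [r0 ur] := lrepP u0 uu; have [_ wr] := lrepP w0 ww.
  by apply: wker_trans ur _ => //; rewrite e wkerC.
rewrite /lrep (@choose_id _ [pred w' | (w' != [::]) && wker u w'] u w)/= ?u0 ?w0//.
apply: eq_choose => t /=; case: eqVneq => //= t0.
apply/idP/idP; last exact: wker_trans.
by apply: wker_trans => //; rewrite wkerC.
Qed.

Lemma lrep_id u : u != [::] -> wker u u -> lrep (lrep u) = lrep u.
Proof.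
move=> u0 uu; have [r0 ur] := lrepP u0 uu.
by apply/esym/eqP; rewrite lrep_eq// (wker_refl u0).
Qed.

(** The action of a letter is well defined on classes: w is replaced after moving the letter to the
    side of u. *)
Lemma wker_lrep_cons c u w : u != [::] -> w != [::] -> wker u u -> wker w w ->
  wker (lrep u) (c :: lrep w) = wker u (c :: w).
Proof.
move=> u0 w0 uu ww; have [r0 ur] := lrepP u0 uu; have [s0 ws] := lrepP w0 ww.
transitivity (wker u (c :: lrep w)).
  by apply/idP/idP; apply: wker_trans => //; rewrite wkerC.
rewrite !wker_cons.
by apply/idP/idP => h; apply: (wker_trans _ _ _ h) => //; rewrite wkerC.
Qed.

Context (R : realType).

Lemma big_at_most_one (s : seq (seq G)) (P : pred (seq G)) : uniq s ->
  (forall t t', t \in s -> t' \in s -> P t -> P t' -> t = t') ->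
  \sum_(t <- s) (P t)%:R <= 1 :> R.
Proof.
move=> us h; have [/hasP[t ts Pt]|/hasPn hs] := boolP (has P s).
  rewrite (bigD1_seq t)//= Pt big_seq_cond big1 ?addr0// => t' /andP[ts' tt'].
  case: (boolP (P t')) => // Pt'; case/eqP: tt'; exact: h.
by rewrite big_seq big1// => t /hs /negPf ->.
Qed.

Variable (n : nat).
Implicit Types (A : G -> 'M[R[i]]_n.+1) (d e : seq G -> 'cV[R[i]]_n.+1).

(* The form [<d, (1 - Gamma) e>], where the vectors d_u sitting at words u of the same
   class of [~] are added up. *)
Definition gram_shift A (W : seq (seq G)) d e : R :=
  \sum_(u <- W) \sum_(w <- W)
    ((wker u w)%:R * rdot (d u) (e w) -
     \sum_c (wker u (c :: w))%:R * rdot (d u) (A c *m e w)).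

(** Adding the d_u over each class gives vectors Y_s, and the first part of the form becomes T, the
    sum of the |Y_s|^2. A letter is a partial injection on classes, so its term is at most r T; the
    #|G| letters together contribute at most T. *)
Lemma gram_shift_ge0 A W d r :
  (forall a, opnorm (A a) <= r) -> #|G|%:R * r <= 1 -> [::] \notin W ->
  0 <= gram_shift A W d d.
Proof.
move=> hA gr W0.
have Wn u : u \in W -> u != [::] by move=> uW; apply: contraNneq W0 => <-.
pose S := undup [seq lrep u | u <- [seq u <- W | wker u u]].
pose Y s : 'cV[R[i]]_n.+1 := \sum_(u <- W | wker u u && (lrep u == s)) d u.
have SP s : s \in S -> [/\ s != [::], wker s s & lrep s = s].
  rewrite mem_undup => /mapP[u]; rewrite mem_filter => /andP[uu uW] ->.
  have [r0 ur] := lrepP (Wn _ uW) uu.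
  by split=> //; [exact: wker_refl (Wn _ uW) _ ur | exact: lrep_id (Wn _ uW) uu].
(* A double sum over words whose coefficients depend only on classes collapses to one over
   representatives. *)
have expand (B : 'M[R[i]]_n.+1) (k l : seq G -> seq G -> bool) :
    (forall u w, u \in W -> w \in W -> l u w =
      [&& wker u u, wker w w & k (lrep u) (lrep w)]) ->
    \sum_(u <- W) \sum_(w <- W) (l u w)%:R * rdot (d u) (B *m d w) =
    \sum_(s <- S) \sum_(t <- S) (k s t)%:R * rdot (Y s) (B *m Y t).
  move=> hl.
  (* Summing over the fibres of [lrep] amounts to summing over the words with [u ~ u]. *)
  have pick (V : zmodType) (F : seq G -> seq G -> V) :
      \sum_(s <- S) \sum_(u <- W | wker u u && (lrep u == s)) F s u =
      \sum_(u <- W | wker u u) F (lrep u) u.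
    rewrite (exchange_big_dep (fun u => wker u u))/=; last by move=> s u _ /andP[].
    rewrite big_seq_cond [RHS]big_seq_cond; apply: eq_bigr => u /andP[uW uu].
    rewrite uu /= -big_filter (perm_big [:: lrep u]) ?big_seq1//.
    apply: uniq_perm; rewrite ?filter_uniq ?undup_uniq// => s.
    rewrite mem_filter mem_seq1 eq_sym; case: eqVneq => //= ->.
    by rewrite mem_undup map_f// mem_filter uu.
  transitivity (\sum_(u <- W | wker u u) \sum_(w <- W | wker w w)
      (k (lrep u) (lrep w))%:R * rdot (d u) (B *m d w)).
    rewrite [RHS]big_mkcond; apply: eq_big_seq => u uW.
    case: ifPn => uu; last first.
      by rewrite big_seq big1// => w wW; rewrite hl// (negPf uu) mul0r.
    rewrite [RHS]big_mkcond; apply: eq_big_seq => w wW.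
    by rewrite hl// uu/=; case: (wker w w) => //=; rewrite mul0r.
  rewrite -(pick _ (fun s u => \sum_(w <- W | wker w w)
      (k s (lrep w))%:R * rdot (d u) (B *m d w))).
  apply: eq_bigr => s _.
  have -> : \sum_(u <- W | wker u u && (lrep u == s)) \sum_(w <- W | wker w w)
        (k s (lrep w))%:R * rdot (d u) (B *m d w) =
      \sum_(w <- W | wker w w) (k s (lrep w))%:R * rdot (Y s) (B *m d w).
    rewrite exchange_big; apply: eq_bigr => w _.
    by rewrite /Y rdot_suml mulr_sumr.
  rewrite -(pick _ (fun t w => (k s t)%:R * rdot (Y s) (B *m d w))).
  apply: eq_bigr => t _.
  by rewrite /Y mulmx_sumr rdot_sumr mulr_sumr.
pose T := \sum_(s <- S) vnorm (Y s) ^+ 2.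
have hF : \sum_(u <- W) \sum_(w <- W) (wker u w)%:R * rdot (d u) (d w) = T.
  under eq_bigr do under eq_bigr do rewrite -[X in rdot _ X]mul1mx.
  rewrite (expand _ (fun s t => s == t)); last first.
    move=> u w uW wW; apply/idP/and3P => [uw|[uu ww]]; last first.
      by rewrite lrep_eq// Wn.
    have uu : wker u u by apply: (wker_refl (Wn _ wW) (Wn _ uW)); rewrite wkerC.
    have ww : wker w w by apply: (wker_refl (Wn _ uW) (Wn _ wW)).
    by split; rewrite ?lrep_eq// Wn.
  apply: eq_big_seq => s sS.
  rewrite (bigD1_seq s)/= ?undup_uniq// eqxx mul1r mul1mx -sqr_vnorm.
  by rewrite big1 ?addr0// => t ts; rewrite eq_sym (negPf ts) mul0r.
have hG c : \sum_(u <- W) \sum_(w <- W)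
    (wker u (c :: w))%:R * rdot (d u) (A c *m d w) <= r * T.
  rewrite (expand _ (fun s t => wker s (c :: t))); last first.
    move=> u w uW wW; have [u0 w0] := (Wn _ uW, Wn _ wW).
    apply/idP/and3P => [ucw|[uu ww]]; last by rewrite wker_lrep_cons.
    have uu : wker u u by apply: (@wker_refl (c :: w)); rewrite // wkerC.
    have ww : wker w w.
      by apply: (@wker_refl (star c :: u)); rewrite // -wker_cons.
    by split; rewrite // wker_lrep_cons.
  have r0 : 0 <= r := le_trans (opnorm_ge0 _) (hA c).
  (* Cauchy-Schwarz followed by 2 |Y_s| |Y_t| <= |Y_s|^2 + |Y_t|^2, which separates source and
     target. *)
  apply: (@le_trans _ _ (\sum_(s <- S) \sum_(t <- S) (wker s (c :: t))%:R *
      (r / 2 * vnorm (Y s) ^+ 2 + r / 2 * vnorm (Y t) ^+ 2))).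
    apply: ler_sum => s _; apply: ler_sum => t _; rewrite ler_wpM2l//.
    apply: le_trans (rdot_le _ _) _.
    apply: (@le_trans _ _ (vnorm (Y s) * (r * vnorm (Y t)))).
      rewrite ler_wpM2l ?vnorm_ge0//; apply: le_trans (vnorm_mul _ _) _.
      by rewrite ler_wpM2r ?vnorm_ge0.
    have : 0 <= r * (vnorm (Y s) - vnorm (Y t)) ^+ 2 by rewrite mulr_ge0 ?sqr_ge0.
    lra.
  under eq_bigr do (under eq_bigr do rewrite mulrDr; rewrite big_split /=).
  rewrite big_split /=.
  have one_sum (F : seq G -> seq G -> bool) :
      (forall s t t', s \in S -> t \in S -> t' \in S -> F s t -> F s t' -> t = t') ->
      \sum_(s <- S) \sum_(t <- S) (F s t)%:R * (r / 2 * vnorm (Y s) ^+ 2) <= r / 2 * T.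
    move=> hF1; rewrite /T mulr_sumr big_seq [leRHS]big_seq; apply: ler_sum => s sS.
    rewrite -mulr_suml ler_piMl//; first by rewrite mulr_ge0 ?sqr_ge0 ?divr_ge0.
    apply: big_at_most_one; first exact: undup_uniq.
    by move=> t t' tS tS'; exact: hF1.
  have -> : r * T = r / 2 * T + r / 2 * T by field.
  apply: lerD.
    (* Injectivity: if s is related to c t and to c t', then c^* s is related to t and to t'. *)
    apply: one_sum => s t t' sS tS tS' st st'.
    have [s0 ss _] := SP _ sS; have [t0 tt <-] := SP _ tS; have [t0' tt' <-] := SP _ tS'.
    apply/eqP; rewrite lrep_eq//; rewrite !wker_cons in st st'.
    by apply: wker_trans _ st' => //; rewrite wkerC.
  (* Single-valuedness: two representatives related to the same c s coincide. *)
  rewrite exchange_big /=; apply: one_sum => s t t' sS tS tS' st st'.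
  have [s0 ss _] := SP _ sS; have [t0 tt <-] := SP _ tS; have [t0' tt' <-] := SP _ tS'.
  apply/eqP; rewrite lrep_eq//.
  by apply: wker_trans st _ => //; rewrite wkerC.
have T0 : 0 <= T by apply: sumr_ge0 => s _; rewrite sqr_ge0.
rewrite /gram_shift.
under eq_bigr do rewrite big_split /=.
rewrite big_split /= hF.
under eq_bigr do rewrite sumrN exchange_big /=.
rewrite sumrN exchange_big /= subr_ge0.
apply: (@le_trans _ _ (\sum_(c : G) r * T)); first by apply: ler_sum => c _; exact: hG.
by rewrite sumr_const -mulr_natl mulrA ler_piMl.
Qed.

End Kernel.

(** * The variational formula on words of bounded length *)

Section TruncatedConvexity.
Context (R : realType) (G : finType) (star : G -> G) (starK : involutive star).
Context (L : set (seq G)) (pyth : pythagorean star L).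
Context (n : nat).
Implicit Types (A B : G -> 'M[R[i]]_n.+1) (d e : seq G -> 'cV[R[i]]_n.+1).
Implicit Types (v : 'cV[R[i]]_n.+1) (N : nat).

Local Notation ker := (wker star L).
Local Notation Q A N := (gram_shift star L A (words_between G 1 N.+1)).

(* These vectors solve [(1 - Gamma) y = Lambda v] up to words of length N + 1: in
   [gram_shift_orbit] the sum over w and c telescopes. *)
Definition orbit_vec A v (w : seq G) := word_eval A w *m v.

(** The pairing <d, Lambda v>, where Lambda v carries A_b v at the class of the one-letter word
    b. *)
Definition lin_part A N v d : R :=
  \sum_(u <- words_between G 1 N.+1) \sum_b
    (ker u [:: b])%:R * rdot (d u) (A b *m v).

(** The overflow at length N + 1 left by the telescoping, hence the truncation error. *)
Definition remainder A N v d : R :=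
  \sum_(u <- words_between G 1 N.+1) \sum_(w <- words G N.+1)
    (ker u w)%:R * rdot (d u) (orbit_vec A v w).

Lemma gram_shift_orbit A N v d :
  Q A N d (orbit_vec A v) = lin_part A N v d - remainder A N v d.
Proof.
rewrite /gram_shift /lin_part /remainder -sumrB; apply: eq_bigr => u _.
pose F w := (ker u w)%:R * rdot (d u) (orbit_vec A v w).
have e c w : (ker u (c :: w))%:R * rdot (d u) (A c *m orbit_vec A v w) = F (c :: w).
  by rewrite /F /orbit_vec word_eval_cons mulmxA.
have e1 b : (ker u [:: b])%:R * rdot (d u) (A b *m v) = F [:: b].
  by rewrite /F /orbit_vec word_eval_cons word_eval_nil mulmx1.
under eq_bigr do under eq_bigr do rewrite e.
under [in RHS]eq_bigr do rewrite e1.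
rewrite sumrB; apply/eqP; rewrite subr_eq addrAC eq_sym subr_eq.
by rewrite (big_words_between_shift N F).
Qed.

(** The lengths 2..N+1 are those of the words u^* b with b a letter and 1 <= |u| <= N. *)
Definition trunc_form A N v : R :=
  \sum_(w <- words_between G 2 N.+2 | w \in L) rdot v (word_eval A w *m v).

(** Since <A^u v, A_b v> = <v, A^(u^* b) v>, pairing the orbit with Lambda v enumerates the words of
    L in the form u^* b. *)
Lemma lin_part_orbit A N v : admissible star A ->
  lin_part A N v (orbit_vec A v) = trunc_form A N v.
Proof.
move=> hA; rewrite /lin_part /trunc_form [RHS]big_mkcond !big_words_between [RHS]big_add1.
apply: eq_bigr => k _; rewrite (big_words_star_rcons _ _ starK)//.
apply: eq_bigr => u _; apply: eq_bigr => b _.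
rewrite /wker cats1 -cats1 word_eval_cat word_eval_star// word_eval_cons.
rewrite word_eval_nil mulmx1 -!mulmxA [in RHS]rdot_adj adjmxK /orbit_vec.
by case: ifP; rewrite ?mul1r ?mul0r.
Qed.

Lemma gram_shiftB A (W : seq (seq G)) d e :
  let Q := gram_shift star L A W in
  Q (fun w => d w - e w) (fun w => d w - e w) = Q d d - Q d e - (Q e d - Q e e).
Proof.
have expand (k x1 x2 x3 x4 : R) :
    k * (x1 - x2 - (x3 - x4)) = k * x1 - k * x2 - (k * x3 - k * x4) by ring.
have regroup (x1 x2 x3 x4 y1 y2 y3 y4 : R) :
    x1 - x2 - (x3 - x4) - (y1 - y2 - (y3 - y4)) =
    x1 - y1 - (x2 - y2) - (x3 - y3 - (x4 - y4)) by ring.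
rewrite /gram_shift; do 3 rewrite -sumrB; apply: eq_bigr => u _.
do 3 rewrite -sumrB; apply: eq_bigr => w _.
rewrite rdotBl !rdotBr expand.
have -> : \sum_c (ker u (c :: w))%:R * rdot (d u - e u) (A c *m (d w - e w)) =
    \sum_c (ker u (c :: w))%:R * rdot (d u) (A c *m d w) -
    \sum_c (ker u (c :: w))%:R * rdot (d u) (A c *m e w) -
    (\sum_c (ker u (c :: w))%:R * rdot (e u) (A c *m d w) -
    \sum_c (ker u (c :: w))%:R * rdot (e u) (A c *m e w)).
  do 3 rewrite -sumrB; apply: eq_bigr => c _.
  by rewrite mulmxBr rdotBl !rdotBr expand.
exact: regroup.
Qed.

(** Reindexing the letters by c -> c^* replaces A_c by its adjoint. *)
Lemma gram_shiftC A (W : seq (seq G)) d e : admissible star A ->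
  gram_shift star L A W d e = gram_shift star L A W e d.
Proof.
move=> hA; rewrite /gram_shift exchange_big; apply: eq_bigr => w _.
apply: eq_bigr => u _; rewrite rdotC (wkerC starK pyth); congr (_ - _).
rewrite (reindex_inj (inv_inj starK)); apply: eq_bigr => c _.
rewrite (wker_cons starK) starK (wkerC starK pyth) (hA c) (rdot_adj _ (d u)).
by rewrite adjmxK rdotC.
Qed.

Lemma gram_shift_midpoint A B (W : seq (seq G)) d e :
  2 * gram_shift star L (fun a => 2^-1 *: (A a + B a)) W d e =
  gram_shift star L A W d e + gram_shift star L B W d e.
Proof.
rewrite /gram_shift mulr_sumr -big_split; apply: eq_bigr => u _ /=.
rewrite mulr_sumr -big_split; apply: eq_bigr => w _ /=.
rewrite mulrBr mulr_sumr addrACA -opprD -big_split/=.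
congr (_ - _); first by rewrite [LHS]mulr_natl mulr2n.
apply: eq_bigr => c _.
have -> : 2^-1 = (2^-1)%:C :> R[i] by rewrite fmorphV rmorph_nat.
by rewrite -scalemxAl rdotZr mulmxDl rdotDr -mulrDr [in LHS]mulrCA mulVKf.
Qed.

Lemma lin_part_midpoint A B N v d :
  2 * lin_part (fun a => 2^-1 *: (A a + B a)) N v d =
  lin_part A N v d + lin_part B N v d.
Proof.
rewrite /lin_part mulr_sumr -big_split; apply: eq_bigr => u _ /=.
rewrite mulr_sumr -big_split; apply: eq_bigr => b _ /=.
have -> : 2^-1 = (2^-1)%:C :> R[i] by rewrite fmorphV rmorph_nat.
by rewrite -scalemxAl rdotZr mulmxDl rdotDr; field.
Qed.

Variable r : R.
Hypotheses (r0 : 0 <= r) (gr : #|G|%:R * r <= 2^-1).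

Lemma remainder_le A B N v :
  (forall a, opnorm (A a) <= r) -> (forall a, opnorm (B a) <= r) ->
  `|remainder A N v (orbit_vec B v)| <= 2 * 2^-1 ^+ N * vnorm v ^+ 2.
Proof.
move=> hA hB.
apply: (@le_trans _ _ (\sum_(u <- words_between G 1 N.+1) \sum_(w <- words G N.+1)
    r ^+ size u * vnorm v * (r ^+ size w * vnorm v))).
  apply: le_trans (ler_norm_sum _ _ _) _; apply: ler_sum => u _.
  apply: le_trans (ler_norm_sum _ _ _) _; apply: ler_sum => w _.
  rewrite normrM; apply: (@le_trans _ _ (1 * `|rdot (orbit_vec B v u) (orbit_vec A v w)|)).
    by rewrite ler_wpM2r// ger0_norm// lern1 leq_b1.
  rewrite mul1r; apply: le_trans (rdot_abs_le _ _) _.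
  by apply: ler_pM; rewrite ?vnorm_ge0// vnorm_word_eval.
have -> : \sum_(u <- words_between G 1 N.+1) \sum_(w <- words G N.+1)
    r ^+ size u * vnorm v * (r ^+ size w * vnorm v) =
    (\sum_(u <- words_between G 1 N.+1) r ^+ size u) *
    (\sum_(w <- words G N.+1) r ^+ size w) * vnorm v ^+ 2.
  rewrite !mulr_suml; apply: eq_bigr => u _.
  by rewrite mulr_sumr mulr_suml; apply: eq_bigr => w _; ring.
rewrite ler_wpM2r ?sqr_ge0// sum_words_expr.
apply: ler_pM; first by apply: sumr_ge0 => *; rewrite exprn_ge0.
- by rewrite exprn_ge0// mulr_ge0.
- rewrite -[2]mulr1 -(expr0 (2^-1 : R)).
  by apply: sum_long_words_half_le => //; exact: words_between_uniq.
apply: (@le_trans _ _ (2^-1 ^+ N.+1)); first by rewrite lerXn2r ?nnegrE ?mulr_ge0.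
by rewrite exprS ler_piMl// ?exprn_ge0// invf_le1 ?ler1n.
Qed.

(** The orbit y of the midpoint tuple is a common test vector: for X = A, B the form of X is at
    least 2 <y, Lambda_X v> - Q_X(y, y) up to remainders. This bound is affine in X, and at the
    midpoint it is attained up to remainders. The remainders enter with total weight 8, each at most
    2 * 2^-N |v|^2, whence 16. *)
Lemma truncated_convexity A B N v :
  nc_ball star r A -> nc_ball star r B ->
  2 * trunc_form (fun a => 2^-1 *: (A a + B a)) N v <=
    trunc_form A N v + trunc_form B N v + 16 * (2^-1 ^+ N * vnorm v ^+ 2).
Proof.
move=> hA hB; set M := fun a => _.
have hM : nc_ball star r M by exact: nc_ball_midpoint.
have hAr a : opnorm (A a) <= r := nc_ball_letter a hA.
have hBr a : opnorm (B a) <= r := nc_ball_letter a hB.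
have hMr a : opnorm (M a) <= r := nc_ball_letter a hM.
pose y := orbit_vec M v.
have gr1 : #|G|%:R * r <= 1 by apply: le_trans gr _; rewrite invf_le1 ?ler1n.
have W0 : [::] \notin words_between G 1 N.+1 by rewrite mem_words_between.
(* Positivity of the form at y minus the orbit of X, with the square expanded. *)
have pos X : nc_ball star r X ->
    0 <= Q X N y y - 2 * (lin_part X N v y - remainder X N v y) +
         (trunc_form X N v - remainder X N v (orbit_vec X v)).
  move=> hX; have := gram_shift_ge0 starK pyth (fun w => y w - orbit_vec X v w)
    (fun a => nc_ball_letter a hX) gr1 W0.
  rewrite gram_shiftB (gram_shiftC _ (orbit_vec X v) y hX.1) !gram_shift_orbit.
  rewrite lin_part_orbit; last exact: hX.1.
  move: (Q X N y y) (lin_part X N v y) (remainder X N v y) (trunc_form X N v).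
  move: (remainder X N v (orbit_vec X v)) => x1 x2 x3 x4 x5; lra.
have := pos _ hA; have := pos _ hB.
have := gram_shift_midpoint A B (words_between G 1 N.+1) y y.
have := lin_part_midpoint A B N v y.
have : Q M N y y = trunc_form M N v - remainder M N v y.
  by rewrite gram_shift_orbit lin_part_orbit//; exact: hM.1.
have : lin_part M N v y = trunc_form M N v by rewrite lin_part_orbit//; exact: hM.1.
rewrite -/M => -> ->.
move: (Q A N y y) (Q B N y y) (lin_part A N v y) (lin_part B N v y) => QA QB lA lB.
have bound X Y (hX : forall a, opnorm (X a) <= r) (hY : forall a, opnorm (Y a) <= r) :
    - (2 * (2^-1 ^+ N * vnorm v ^+ 2)) <= remainder X N v (orbit_vec Y v) <=
    2 * (2^-1 ^+ N * vnorm v ^+ 2) by rewrite -ler_norml mulrA remainder_le.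
have /andP[h1 h2] : _ <= remainder A N v y <= _ := bound _ _ hAr hMr.
have /andP[h3 h4] : _ <= remainder B N v y <= _ := bound _ _ hBr hMr.
have /andP[h5 h6] : _ <= remainder M N v y <= _ := bound _ _ hMr hMr.
have /andP[h7 h8] := bound _ _ hAr hAr.
have /andP[h9 h10] := bound _ _ hBr hBr.
move: h1 h2 h3 h4 h5 h6 h7 h8 h9 h10.
move: (remainder A N v y) (remainder B N v y) (remainder M N v y) => sA sB sM.
move: (remainder A N v (orbit_vec A v)) (remainder B N v (orbit_vec B v)) => zA zB.
move: (trunc_form A N v) (trunc_form B N v) (trunc_form M N v) => fA fB fM.
move: (2^-1 ^+ N * vnorm v ^+ 2) => eta.
lra.
Qed.

End TruncatedConvexity.

(** * Convergence of the enumeration function *)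

Section Truncation.
Context (G : finType) (N : nat).

Definition short_words : {fset seq G} := [fset w in words_between G 0 N.+1]%fset.

Lemma mem_short_words w : (w \in short_words) = (size w <= N)%N.
Proof. by rewrite in_fset /= mem_words_between. Qed.

Lemma big_short_words (V : nmodType) (F : {fset seq G}) (P : pred (seq G))
    (f : seq G -> V) : (short_words `<=` F)%fset ->
  \sum_(w <- F | P w) f w = \sum_(w <- words_between G 0 N.+1 | P w) f w +
    \sum_(w <- F | P w && (N < size w)%N) f w.
Proof.
move=> sF; rewrite (bigID (fun w => (N < size w)%N)) /= addrC; congr (_ + _).
under eq_bigl do rewrite -leqNgt.
rewrite -big_filter -[RHS]big_filter; apply: perm_big; apply: uniq_perm.
- by rewrite filter_uniq// fset_uniq.
- by rewrite filter_uniq// words_between_uniq.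
move=> w; rewrite !mem_filter mem_words_between ltnS/=.
case: (P w) => //=; case: (boolP (size w <= N)%N) => //= sw.
by apply: (fsubsetP sF); rewrite mem_short_words.
Qed.

End Truncation.

Lemma vanishing_half (R : realType) (eps : R) : 0 < eps -> exists N, 2^-1 ^+ N < eps.
Proof.
move=> e0; have := @cvg_expr R 2^-1.
rewrite ger0_norm ?invr_ge0// invf_lt1// ltr1n => /(_ isT)/cvgr0_norm_lt.
move=> /(_ _ e0)[N _ hN]; exists N.
by have := hN N (leqnn N); rewrite ger0_norm// exprn_ge0.
Qed.

Section Convergence.
Context (R : realType) (G : finType) (L : set (seq G)) (r : R).
Hypotheses (r0 : 0 <= r) (gr : #|G|%:R * r <= 2^-1).
Context (n : nat) (A : G -> 'M[R[i]]_n.+1).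
Hypothesis Ar : forall a, opnorm (A a) <= r.

Definition trunc_eval N : 'M[R[i]]_n.+1 :=
  \sum_(w <- words_between G 0 N.+1 | w \in L) word_eval A w.

Lemma enum_partial_trunc N (F : {fset seq G}) : (short_words G N `<=` F)%fset ->
  opnorm (enum_partial L A F - trunc_eval N) <= 2^-1 ^+ N.
Proof.
move=> sF; rewrite /enum_partial (big_short_words _ _ sF) addrC addKr.
apply: le_trans (opnorm_sum _ _ _) _.
apply: (@le_trans _ _ (\sum_(w <- F | (w \in L) && (N < size w)%N) r ^+ size w)).
  by apply: ler_sum => w _; exact: opnorm_word_eval.
rewrite -big_filter; have -> : 2^-1 ^+ N = 2 * 2^-1 ^+ N.+1 :> R.
  by rewrite exprS mulrA divff// mul1r.
apply: sum_long_words_half_le => //; first by rewrite filter_uniq// fset_uniq.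
by move=> w; rewrite mem_filter => /andP[/andP[]].
Qed.

Lemma near_short_words N : \forall F \near totally, (short_words G N `<=` F)%fset.
Proof. by exists (short_words G N). Qed.

(** Here [h] stands for the real or the imaginary part; both are 1-Lipschitz, and completeness of
    [R] applies to each. *)
Lemma enum_partial_entry_cvg (h : R[i] -> R) i j :
  (forall x y, `|h x - h y| <= normc (x - y)) ->
  cvg ((fun F : {fset seq G} => h (enum_partial L A F i j)) @ totally).
Proof.
move=> hh; apply/cauchy_cvgP/cauchy_exP => eps e0.
have [N hN] := vanishing_half e0.
exists (h (trunc_eval N i j)).
suff : \forall F \near totally, ball (h (trunc_eval N i j)) eps (h (enum_partial L A F i j)) by [].
apply: filterS (near_short_words N) => F sF.
rewrite /ball/= distrC; apply: le_lt_trans (hh _ _) _; apply: le_lt_trans hN.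
have -> : enum_partial L A F i j - trunc_eval N i j =
  (enum_partial L A F - trunc_eval N) i j by rewrite !mxE.
by apply: le_trans (normc_entry_le _ _ _) _; exact: enum_partial_trunc.
Qed.

Lemma normc_le_ReIm (x : R[i]) : normc x <= `|cRe x| + `|complex.Im x|.
Proof.
case: x => a b /=.
rewrite -(@ler_pXn2r _ 2)// ?nnegrE ?addr_ge0 ?sqrtr_ge0//.
rewrite sqr_sqrtr ?addr_ge0 ?sqr_ge0// sqrrD !real_normK ?num_real//.
by rewrite lerD2r lerDl mulrn_wge0// mulr_ge0.
Qed.

Lemma Re_le_normc (x : R[i]) : `|cRe x| <= normc x.
Proof. by case: x => a b /=; rewrite -sqrtr_sqr ler_wsqrtr// lerDl sqr_ge0. Qed.

Lemma Im_le_normc (x : R[i]) : `|complex.Im x| <= normc x.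
Proof. by case: x => a b /=; rewrite -sqrtr_sqr ler_wsqrtr// lerDr sqr_ge0. Qed.

Lemma enum_partial_is_cvg :
  cvg ((enum_partial L A : _ -> 'M[R[i]^o]_n.+1) @ totally).
Proof.
pose re i j := lim ((fun F : {fset seq G} => cRe (enum_partial L A F i j)) @ totally).
pose im i j := lim ((fun F : {fset seq G} => complex.Im (enum_partial L A F i j)) @ totally).
have hre i j : (fun F : {fset seq G} => cRe (enum_partial L A F i j)) @ totally --> re i j.
  apply: enum_partial_entry_cvg => x y; rewrite -ReN -ReD; exact: Re_le_normc.
have him i j : (fun F : {fset seq G} => complex.Im (enum_partial L A F i j)) @ totally --> im i j.
  apply: enum_partial_entry_cvg => -[? ?] [? ?]; exact: (Im_le_normc (_ +i* _ - _ +i* _)).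
apply/cvg_ex; exists (\matrix_(i, j) (re i j +i* im i j) : 'M[R[i]^o]_n.+1).
apply/cvg_ballP => eps e0.
(* A positive element of [R[i]] is a positive real. *)
have [d d0 ->] : exists2 d : R, 0 < d & eps = d%:C.
  case: eps e0 => a b; rewrite ltcE /= => /andP[/eqP -> a0].
  by exists a.
have d20 : 0 < d / 2 by rewrite divr_gt0.
(* Half of d for each of the real and imaginary parts; there are finitely many entries, so one F
   serves all of them. *)
suff : \forall F \near totally, forall ij : 'I_n.+1 * 'I_n.+1,
    `|re ij.1 ij.2 - cRe (enum_partial L A F ij.1 ij.2)| < d / 2 /\
    `|im ij.1 ij.2 - complex.Im (enum_partial L A F ij.1 ij.2)| < d / 2.
  apply: filterS => F hF; split=> [|i j]; first by rewrite ltcR.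
  have [h1 h2] := hF (i, j); rewrite mxE -ball_normE /ball_ /= ltcR.
  apply: (le_lt_trans (normc_le_ReIm (re i j +i* im i j - enum_partial L A F i j))).
  rewrite [ltRHS]splitr; move: h1 h2 => /=.
  by case: (enum_partial L A F i j) => x y /= h1 h2; exact: ltrD.
apply: filter_forall => -[i j] /=; near=> F; split; near: F.
- by move/cvgrPdist_lt: (hre i j); exact.
- by move/cvgrPdist_lt: (him i j); exact.
Unshelve. all: by end_near. Qed.

(** The bound for partial sums passes to the limit, through one F that contains the short words and
    is close to the limit. *)
Lemma enum_fun_trunc N : opnorm (trunc_eval N - enum_fun L A) <= 2^-1 ^+ N.
Proof.
apply/ler_addgt0Pr => eps e0.
have n0 : 0 < n.+1%:R * n.+1%:R :> R by rewrite mulr_gt0.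
have : \forall F \near totally,
    opnorm (enum_partial L A F - enum_fun L A) <= eps /\ (short_words G N `<=` F)%fset.
  apply: filterI; last exact: near_short_words.
  (* Each of the (n+1)^2 entries gets an equal share of eps, since the operator norm is bounded by
     the sum of the entries' moduli. *)
  have d0 : 0 < (eps / (n.+1%:R * n.+1%:R))%:C :> R[i] by rewrite ltcR divr_gt0.
  move/cvg_ballP: enum_partial_is_cvg => /(_ _ d0); apply: filterS => F [_ hF].
  apply: le_trans (opnorm_le_sum _) _.
  apply: (@le_trans _ _ (\sum_(i < n.+1) \sum_(j < n.+1) (eps / (n.+1%:R * n.+1%:R)))).
    apply: ler_sum => i _; apply: ler_sum => j _; have := hF i j.
    rewrite -ball_normE /ball_ /= distrC ltcR => /ltW; apply: le_trans.
    by rewrite !mxE.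
  by rewrite !sumr_const card_ord -mulrnA -[leLHS]mulr_natr natrM divfK ?gt_eqF.
case=> F _ hF; have [hF1 sF] := hF F (fsubset_refl F).
have -> : trunc_eval N - enum_fun L A = (trunc_eval N - enum_partial L A F) +
  (enum_partial L A F - enum_fun L A) by rewrite addrA subrK.
apply: le_trans (opnormD _ _) _; apply: lerD => //.
rewrite -opprB; apply: le_trans (enum_partial_trunc sF).
have -> : - (enum_partial L A F - trunc_eval N) = (-1)%:C *: (enum_partial L A F - trunc_eval N).
  by rewrite rmorphN1 scaleN1r.
by apply: le_trans (opnormZ_real _ _) _; rewrite normrN1 mul1r.
Qed.

End Convergence.

Lemma le0_geometric (R : realType) (x c : R) :
  (forall N, x <= c * 2^-1 ^+ N) -> x <= 0.
Proof.
move=> h; rewrite leNgt; apply/negP => x0.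
have c0 : 0 < c by have := h 0; rewrite expr0 mulr1; exact: lt_le_trans.
have [N] := vanishing_half (divr_gt0 x0 c0).
by rewrite ltr_pdivlMr// mulrC ltNge h.
Qed.

(** * Pythagorean implies matrix convex: passage to the limit *)

Section PythagoreanConvex.
Context (R : realType) (G : finType) (star : G -> G) (starK : involutive star).
Context (L : set (seq G)) (pyth : pythagorean star L).
Context (r : R) (r0 : 0 <= r) (gr : #|G|%:R * r <= 2^-1).

Lemma pythagorean_abs_convergent : abs_convergent_on star L r.
Proof.
move=> n A hA; apply: le_lt_trans (ltry 2).
apply: ge_ereal_sup => _ [X [finX XL] <-].
rewrite fsbig_finite//= sumEFin lee_fin.
apply: (@le_trans _ _ (\sum_(w <- fset_set X) r ^+ size w)).
  apply: ler_sum => w _; rewrite ger0_norm ?opnorm_ge0//.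
  exact: opnorm_word_eval (fun a => nc_ball_letter a hA).
have -> : 2 = 2 * 2^-1 ^+ 0 :> R by rewrite expr0 mulr1.
by apply: sum_long_words_half_le => //; exact: fset_uniq.
Qed.

Lemma pythagorean_unif_convergent : unif_convergent_on star L r.
Proof.
move=> eps e0; have [N hN] := vanishing_half (divr_gt0 e0 (ltr0Sn R 1)).
apply: filterS (near_short_words G N) => F sF n A hA.
have hr a : opnorm (A a) <= r := nc_ball_letter a hA.
rewrite -(subrK (trunc_eval L A N) (enum_partial L A F)) -addrA.
apply: le_lt_trans (opnormD _ _) _; rewrite [ltRHS]splitr; apply: ltrD.
  exact: le_lt_trans (enum_partial_trunc L r0 gr hr sF) hN.
exact: le_lt_trans (enum_fun_trunc L r0 gr hr N) hN.
Qed.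

(** The map w -> w^* permutes the words of L of length at most N and turns A^w into its adjoint. *)
Lemma trunc_eval_herm n (A : G -> 'M[R[i]]_n.+1) N : admissible star A ->
  (trunc_eval L A N) ^t* = trunc_eval L A N.
Proof.
move=> hA; rewrite /trunc_eval raddf_sum map_mx_sum.
have -> : \sum_(w <- words_between G 0 N.+1 | w \in L) (word_eval A w) ^t* =
    \sum_(w <- [seq word_star star w | w <- words_between G 0 N.+1] | w \in L)
      word_eval A w.
  rewrite big_map; apply: eq_big => [w|w _]; last by rewrite (word_eval_star _ hA).
  by rewrite (selfadjoint_mem starK pyth.1).
have inj := inv_inj (word_starK starK).
apply: perm_big; apply: uniq_perm; rewrite ?map_inj_uniq ?words_between_uniq// => w.
by rewrite -[w](word_starK starK) mem_map// !mem_words_between !size_word_star.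
Qed.

Lemma pythagorean_herm n (A : G -> 'M[R[i]]_n.+1) : nc_ball star r A ->
  enum_fun L A = (enum_fun L A) ^t*.
Proof.
move=> hA; apply/matrixP => i j; rewrite [RHS]mxE [in RHS]mxE.
apply/eqP; rewrite -subr_eq0; apply/eqP/ComplexField.Normc.eq0_normc/eqP.
rewrite eq_le normc_ge0 andbT; apply: (@le0_geometric _ _ 2) => N.
have hr a : opnorm (A a) <= r := nc_ball_letter a hA.
have close k l : normc (enum_fun L A k l - trunc_eval L A N k l) <= 2^-1 ^+ N.
  apply: le_trans (enum_fun_trunc L r0 gr hr N).
  rewrite -normcN opprB; apply: le_trans (normc_entry_le _ k l).
  by rewrite !mxE.
have -> : enum_fun L A i j - Num.conj (enum_fun L A j i) =
    (enum_fun L A i j - trunc_eval L A N i j) +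
    Num.conj (trunc_eval L A N j i - enum_fun L A j i).
  rewrite rmorphB /= -{2}(trunc_eval_herm N hA.1) !mxE conjCK; ring.
apply: le_trans (normcD _ _) _; rewrite mulr_natl mulr2n; apply: lerD => //.
by rewrite conjCE normc_conj -normcN opprB.
Qed.

(** The words of length at most one give the part of f that is affine in A, for which midpoint
    convexity is an equality. *)
Definition affine_form n (A : G -> 'M[R[i]]_n.+1) v : R :=
  \sum_(w <- words_between G 0 2 | w \in L) rdot v (word_eval A w *m v).

Lemma rdot_trunc_split n (A : G -> 'M[R[i]]_n.+1) N v :
  rdot v (trunc_eval L A N.+1 *m v) = affine_form A v + trunc_form L A N v.
Proof.
rewrite /trunc_eval mulmx_suml rdot_sumr /trunc_form /affine_form.
rewrite big_mkcond [in RHS]big_mkcond [X in _ = _ + X]big_mkcond.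
by rewrite !big_words_between (@big_cat_nat _ _ _ 2).
Qed.

Lemma affine_form_midpoint n (A B : G -> 'M[R[i]]_n.+1) v :
  2 * affine_form (fun a => 2^-1 *: (A a + B a)) v =
  affine_form A v + affine_form B v.
Proof.
have half : 2^-1 = (2^-1)%:C :> R[i] by rewrite fmorphV rmorph_nat.
rewrite /affine_form mulr_sumr -big_split big_seq_cond [RHS]big_seq_cond /=.
apply: eq_bigr => w; rewrite mem_words_between => /andP[/andP[_ w2] _].
case: w w2 => [|a [|b w]] w2; last by [].
  by rewrite !word_eval_nil mulr_natl mulr2n.
rewrite !word_eval_cons !word_eval_nil !mulmx1 half -scalemxAl rdotZr.
by rewrite mulmxDl rdotDr mulVKf.
Qed.

Lemma rdot_enum_fun_bounds n (A : G -> 'M[R[i]]_n.+1) N v : nc_ball star r A ->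
  - (2^-1 ^+ N * vnorm v ^+ 2) <=
    affine_form A v + trunc_form L A N v - rdot v (enum_fun L A *m v) <=
  2^-1 ^+ N * vnorm v ^+ 2.
Proof.
move=> hA; rewrite -ler_norml -rdot_trunc_split -rdotBr -mulmxBl.
apply: le_trans (rdot_abs_le _ _) _.
rewrite expr2 mulrCA ler_wpM2l ?vnorm_ge0//; apply: le_trans (vnorm_mul _ _) _.
rewrite ler_wpM2r ?vnorm_ge0//.
apply: le_trans (enum_fun_trunc L r0 gr (fun a => nc_ball_letter a hA) N.+1) _.
by rewrite exprS ler_piMl ?exprn_ge0// invf_le1 ?ler1n.
Qed.

Lemma pythagorean_matrix_convex : matrix_convex star L r.
Proof.
split; first exact: pythagorean_abs_convergent.
- exact: pythagorean_unif_convergent.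
- by move=> n A hA; apply/hermsymmxP; exact: pythagorean_herm.
move=> n A B hA hB; have hM := nc_ball_midpoint hA hB r0.
have half : 2^-1 = (2^-1)%:C :> R[i] by rewrite fmorphV rmorph_nat.
have halfJ : Num.conj (2^-1 : R[i]) = 2^-1 by rewrite {1}half conjCE conjc_real -half.
apply/psdmxP; split=> [|v].
  have e1 := pythagorean_herm hA; have e2 := pythagorean_herm hB.
  have e3 := pythagorean_herm hM; rewrite {1}e1 {1}e2 {1}e3.
  by apply/matrixP => i j; rewrite !mxE rmorphB rmorphM rmorphD /= halfJ.
set M := fun a => _ in hM *.
rewrite mulmxBl rdotBr half -scalemxAl rdotZr mulmxDl rdotDr -oppr_le0.
(* After halving, truncated convexity costs 8 and the three truncations cost 2 units of 2^-N |v|^2,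
   so 16 is ample. *)
apply: (@le0_geometric _ _ (16 * vnorm v ^+ 2)) => N.
have := truncated_convexity starK pyth r0 gr N v hA hB; rewrite -/M.
have /andP[] := rdot_enum_fun_bounds N v hM.
have /andP[] := rdot_enum_fun_bounds N v hA.
have /andP[] := rdot_enum_fun_bounds N v hB.
have := affine_form_midpoint A B v; rewrite -/M.
rewrite -mulrA (mulrC (vnorm v ^+ 2)).
move: (affine_form A v) (affine_form B v) (affine_form M v) => sA sB sM.
move: (trunc_form L A N v) (trunc_form L B N v) (trunc_form L M N v) => fA fB fM.
move: (rdot v (enum_fun L A *m v)) (rdot v (enum_fun L B *m v)) => eA eB.
move: (rdot v (enum_fun L M *m v)) (2^-1 ^+ N * vnorm v ^+ 2) => eM z.
lra.
Qed.

End PythagoreanConvex.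

(** * Walks in graphs with small weights *)

Section LeadingTerm.
Context (R : realType).
Implicit Types (d e : nat) (u c : R) (X Y : R -> R).

(* [X t = u t^d + O(t^(d+1))] on the interval ]0, 1]. *)
Definition lead d u X := exists2 C : R, 0 <= C &
  forall t, 0 < t <= 1 -> `|X t - u * t ^+ d| <= C * t ^+ d.+1.

Lemma eq_lead d u u' X Y : u = u' -> (forall t, X t = Y t) -> lead d u X -> lead d u' Y.
Proof. by move=> -> XY [C C0 h]; exists C => // t t1; rewrite -XY h. Qed.

Lemma lead_0 d : lead d 0 (fun=> 0).
Proof.
by exists 0 => // t /andP[/ltW t0 _]; rewrite !mul0r subrr normr0.
Qed.

Lemma lead_D d u u' X Y : lead d u X -> lead d u' Y ->
  lead d (u + u') (fun t => X t + Y t).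
Proof.
move=> [C C0 hX] [C' C'0 hY]; exists (C + C'); first exact: addr_ge0.
move=> t t1; have -> : X t + Y t - (u + u') * t ^+ d =
  (X t - u * t ^+ d) + (Y t - u' * t ^+ d) by ring.
by apply: le_trans (ler_normD _ _) _; rewrite mulrDl lerD ?hX ?hY.
Qed.

Lemma lead_sum (I : Type) (s : seq I) (P : pred I) d (u : I -> R) (X : I -> R -> R) :
  (forall i, P i -> lead d (u i) (X i)) ->
  lead d (\sum_(i <- s | P i) u i) (fun t => \sum_(i <- s | P i) X i t).
Proof.
move=> h; elim: s => [|i s IH].
  by apply: eq_lead (lead_0 d) => [|t]; rewrite big_nil.
have [Pi|nPi] := boolP (P i).
  by apply: eq_lead (lead_D (h i Pi) IH) => [|t]; rewrite big_cons Pi.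
by apply: eq_lead IH => [|t]; rewrite big_cons (negPf nPi).
Qed.

Lemma lead_Mpow d e c u X : lead d u X -> lead (e + d) (c * u) (fun t => c * t ^+ e * X t).
Proof.
move=> [C C0 h]; exists (`|c| * C); first by rewrite mulr_ge0.
move=> t t1; have /andP[/ltW t0 _] := t1.
have -> : c * t ^+ e * X t - c * u * t ^+ (e + d) =
  c * t ^+ e * (X t - u * t ^+ d) by rewrite exprD; ring.
rewrite normrM normrM (ger0_norm (exprn_ge0 _ t0)) -addnS exprD.
rewrite -!mulrA ler_wpM2l// (mulrCA C) ler_wpM2l ?exprn_ge0//; exact: h.
Qed.

Lemma lead_lower d d' u X : (d < d')%N -> lead d' u X -> lead d 0 X.
Proof.
move=> dd' [C C0 h]; exists (C + `|u|); first by rewrite addr_ge0.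
move=> t t1; have /andP[/ltW t0 t1'] := t1; rewrite mul0r subr0.
rewrite -(subrK (u * t ^+ d') (X t)); apply: le_trans (ler_normD _ _) _.
rewrite mulrDl lerD//.
  apply: le_trans (h _ t1) _; rewrite ler_wpM2l// ler_wiXn2l//; lia.
by rewrite normrM ler_wpM2l// ger0_norm ?exprn_ge0// ler_wiXn2l.
Qed.

(** Extracts the sign of a leading coefficient from an inequality that holds up to one further power
    of t. *)
Lemma lead_le0 (a C t0 : R) : 0 < t0 -> (forall t, 0 < t <= t0 -> a <= C * t) -> a <= 0.
Proof.
move=> t00 h; rewrite leNgt; apply/negP => a0.
have C0 : 0 <= `|C| + 1 by rewrite addr_ge0.
(* Small enough that C t <= a / 2 < a. *)
pose t := Num.min t0 (a / 2 / (`|C| + 1)).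
have C1 : 0 < `|C| + 1 by rewrite ltr_pwDr.
have t1 : 0 < t by rewrite lt_min t00 !divr_gt0.
have := h t; rewrite t1 ge_min lexx /= => /(_ isT).
have : t * (`|C| + 1) <= a / 2 by rewrite -ler_pdivlMr// ge_min lexx orbT.
have : C * t <= `|C| * t by rewrite ler_wpM2r ?ler_norm// ltW.
lra.
Qed.

(** Words of length at most d are finitely many and contribute their leading terms; the longer ones
    form a geometric tail of order t^(d+1). The constants do not depend on F. *)
Lemma lead_big_words (G : finType) (P : pred (seq G)) d (u : seq G -> R)
    (X : seq G -> R -> R) (c K : R) :
  0 <= c -> 0 <= K ->
  (forall w, lead d (u w) (X w)) ->
  (forall w t, 0 < t <= 1 -> `|X w t| <= c * (K * t) ^+ size w) ->
  exists C, exists2 t0, 0 < t0 & forall t, 0 < t <= t0 -> forall F,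
    (short_words G d `<=` F)%fset ->
    `|\sum_(w <- F | P w) X w t -
      (\sum_(w <- words_between G 0 d.+1 | P w) u w) * t ^+ d| <= C * t ^+ d.+1.
Proof.
move=> c0 K0 hu hX; have [C C0 hC] := lead_sum (words_between G 0 d.+1) (fun w (_ : P w) => hu w).
pose g : R := #|G|%:R.
have g0 : 0 <= g by [].
(* For t <= 1/B the ratio #|G| K t of the tail is at most 1/2. *)
pose B := 2 * (g * K) + 1.
have B1 : 1 <= B by rewrite lerDr !mulr_ge0.
have B0 : 0 < B by rewrite (lt_le_trans ltr01).
exists (C + c * (2 * (g * K) ^+ d.+1)); exists B^-1; first by rewrite invr_gt0.
move=> t /andP[tp tB] F sF.
have t1 : t <= 1 by apply: le_trans tB _; rewrite invf_le1.
have t01 : 0 < t <= 1 by rewrite tp.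
rewrite (big_short_words _ _ sF).
rewrite addrAC; apply: le_trans (ler_normD _ _) _; rewrite mulrDl lerD ?hC//.
apply: le_trans (ler_norm_sum _ _ _) _.
apply: (@le_trans _ _ (\sum_(w <- F | P w && (d < size w)%N) c * (K * t) ^+ size w)).
  by apply: ler_sum => w _; exact: hX.
rewrite -mulr_sumr -!mulrA ler_wpM2l// -exprMn -(mulrA g) -big_filter.
apply: sum_long_words_le.
- exact: mulr_ge0 K0 (ltW tp).
- have : t * B <= 1 by rewrite -ler_pdivlMr// div1r.
  rewrite /B -/g; nra.
- by rewrite filter_uniq// fset_uniq.
by move=> w; rewrite mem_filter => /andP[/andP[]].
Qed.

End LeadingTerm.

(** * Matrix entries as sums over labelled walks *)

Section Walks.
Context (R : realType) (G : finType) (star : G -> G) (T : finType) (t0 : T).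
Let n := #|T|.-1.

Lemma card_pred : #|T| = n.+1.
Proof. by rewrite prednK//; apply/card_gt0P; exists t0. Qed.

(** Vertices and matrix indices are identified; the point [t0] makes T nonempty, so that its
    cardinal is a successor. *)
Definition node (i : 'I_n.+1) : T := enum_val (cast_ord (esym card_pred) i).
Definition index_of (x : T) : 'I_n.+1 := cast_ord card_pred (enum_rank x).

Lemma index_ofK : cancel index_of node.
Proof. by move=> x; rewrite /node /index_of cast_ordK enum_rankK. Qed.

Lemma nodeK : cancel node index_of.
Proof. by move=> x; rewrite /node /index_of enum_valK cast_ordKV. Qed.

Implicit Types (F : G -> T -> T -> R) (x y z : T).

Definition graph_mx F (a : G) : 'M[R[i]]_n.+1 :=
  \matrix_(i, j) (F a (node i) (node j))%:C.

Fixpoint walk F (w : seq G) x y : R :=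
  if w is a :: w' then \sum_z F a x z * walk F w' z y else (x == y)%:R.

Lemma word_eval_graph F w i j :
  word_eval (graph_mx F) w i j = (walk F w (node i) (node j))%:C.
Proof.
elim: w i j => [|a w IH] i j /=.
  by rewrite word_eval_nil mxE (inj_eq (can_inj nodeK)) rmorph_nat.
rewrite word_eval_cons mxE (reindex node)/=; last first.
  by exists index_of => x _; [exact: nodeK | exact: index_ofK].
by rewrite rmorph_sum; apply: eq_bigr => k _; rewrite mxE IH rmorphM.
Qed.

Lemma enum_partial_graph L F (S : {fset seq G}) i j :
  enum_partial L (graph_mx F) S i j =
  (\sum_(w <- S | w \in L) walk F w (node i) (node j))%:C.
Proof.
rewrite /enum_partial summxE rmorph_sum; apply: eq_bigr => w _.
exact: word_eval_graph.
Qed.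

Lemma walk_cat F u w x y : walk F (u ++ w) x y = \sum_z walk F u x z * walk F w z y.
Proof.
elim: u x => [|a u IH] x /=.
  rewrite (bigD1 x)//= eqxx mul1r big1 ?addr0// => z.
  by rewrite eq_sym => /negPf ->; rewrite mul0r.
under eq_bigr do rewrite IH mulr_sumr.
rewrite exchange_big; apply: eq_bigr => z _.
by rewrite mulr_suml; apply: eq_bigr => z' _; rewrite mulrA.
Qed.

Lemma walk_star F w x y : (forall a x y, F (star a) x y = F a y x) ->
  walk F (word_star star w) x y = walk F w y x.
Proof.
move=> hF; elim: w x y => [|a w IH] x y; first by rewrite /= eq_sym.
rewrite word_star_cons -cats1 walk_cat /=; apply: eq_bigr => z _.
rewrite IH mulrC; congr (_ * _); rewrite (bigD1 y)//= eqxx mulr1 hF.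
by rewrite big1 ?addr0// => z' /negPf ->; rewrite mulr0.
Qed.

Lemma walk_le F (b : R) w x y : (forall a x y, `|F a x y| <= b) ->
  `|walk F w x y| <= (#|T|%:R * b) ^+ size w.
Proof.
move=> hF; elim: w x y => [|a w IH] x y /=.
  by rewrite expr0 ger0_norm// lern1 leq_b1.
apply: le_trans (ler_norm_sum _ _ _) _.
apply: (@le_trans _ _ (\sum_(z : T) b * (#|T|%:R * b) ^+ size w)).
  by apply: ler_sum => z _; rewrite normrM ler_pM.
by rewrite sumr_const exprS -[leLHS]mulr_natl mulrA.
Qed.

Lemma graph_mx_ball F (b r : R) : (forall a x y, F (star a) x y = F a y x) ->
  (forall a x y, `|F a x y| <= b) -> #|T|%:R * (#|T|%:R * b) <= r -> 0 <= r ->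
  nc_ball star r (graph_mx F).
Proof.
move=> hF hb br r0; split=> [a|].
  by apply/matrixP => i j; rewrite !mxE hF conjCE conjc_real.
apply/bigmax_leP; split=> // a _; apply: le_trans (opnorm_le_sum _) (le_trans _ br).
apply: (@le_trans _ _ (\sum_(i < n.+1) \sum_(j < n.+1) b)).
  by do 2![apply: ler_sum => ? _]; rewrite mxE normc_real.
by rewrite !sumr_const !card_ord -card_pred -[in leLHS]mulr_natl -[X in _ * X]mulr_natl.
Qed.

End Walks.

(** * The weighted trie and the leading terms of its walks *)

Section Trie.
Context (R : realType) (G : finType) (star : G -> G) (starK : involutive star).
Context (m : nat).

Local Notation T := (option (m.-bseq G)).
Implicit Types (p q z : T) (s : m.-bseq G) (w : seq G) (a : G) (t : R).

(* [None] is the extra vertex, [Some s] the word s. *)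
Definition trie_root : T := Some [bseq].

Definition height p : nat := if p is Some s then size s else m.+1.

Definition height_dist p q : nat := (height p - height q) + (height q - height p).

(** Within the trie, a joins s' to a s' and a^* joins them in the reverse order. The extra vertex
    replaces the words a s' by their combination with coefficients x(a s'). *)
Definition edge_coef (x : seq G -> R) a p q : R :=
  match p, q with
  | Some s, Some s' => ((s == a :: s' :> seq G) || (s' == star a :: s :> seq G))%:R
  | None, Some s' => x (a :: s')
  | Some s, None => x (star a :: s)
  | None, None => 0
  end.

Definition edge x t a p q : R := edge_coef x a p q * t ^+ height_dist p q.

Lemma edge_star x t a p q : edge x t (star a) p q = edge x t a q p.
Proof.
rewrite /edge /height_dist addnC; congr (_ * _).
by case: p q => [s|] [s'|] //=; rewrite starK// orbC.
Qed.

(** Hence every edge with a nonzero coefficient changes the height and carries at least one factor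
    t. *)
Lemma edge_coef_level x a p q : height p = height q -> edge_coef x a p q = 0.
Proof.
case: p q => [s|] [s'|] //= h; last 2 first.
- by have := size_bseq s; rewrite h ltnn.
- by have := size_bseq s'; rewrite -h ltnn.
have /negPf -> : (s : seq G) != a :: s' by apply/eqP => /(congr1 size)/=; lia.
by have /negPf -> : (s' : seq G) != star a :: s by apply/eqP => /(congr1 size)/=; lia.
Qed.

Lemma edge_le x (X : R) t a p q : 1 <= X -> (forall w, `|x w| <= X) ->
  0 < t <= 1 -> `|edge x t a p q| <= X * t.
Proof.
move=> X1 xX /andP[/ltW t0 t1]; have X0 : 0 <= X := le_trans ler01 X1.
have [pq|pq] := eqVneq (height p) (height q).
  by rewrite /edge edge_coef_level// mul0r normr0 mulr_ge0.
rewrite /edge normrM ler_pM//.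
  case: p q pq => [s|] [s'|] _ //=; rewrite ?normr0//.
  by apply: le_trans X1; rewrite ger0_norm// lern1 leq_b1.
rewrite ger0_norm ?exprn_ge0// -[leRHS]expr1 ler_wiXn2l//.
rewrite /height_dist; move: (height p) (height q) pq => h h'; lia.
Qed.

Lemma big_node (F : T -> R) : \sum_z F z = F None + \sum_s F (Some s).
Proof.
rewrite (bigD1 None)//=; congr (_ + _).
rewrite (reindex_omap Some id)/=; last by case.
by apply: eq_bigl => s; rewrite eqxx.
Qed.

Lemma big_bseq_eq w (F : seq G -> R) :
  \sum_(s : m.-bseq G) (w == s)%:R * F s = (size w <= m)%:R * F w.
Proof.
have [wm|wm] := leqP (size w) m; last first.
  rewrite mul0r big1// => s _.
  have /negPf -> : w != s :> seq G by apply/eqP => ws; have := size_bseq s; rewrite -ws leqNgt wm.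
  by rewrite mul0r.
rewrite (bigD1 (Bseq wm))//= eqxx big1 ?addr0// => s.
by rewrite -val_eqE eq_sym/= => /negPf ->; rewrite mul0r.
Qed.

Local Notation walkx x t := (walk (edge x t)).
Local Notation walk0 t := (walk (edge (fun=> 0) t)).

Lemma walk0_None w t : walk0 t w None trie_root = 0.
Proof.
case: w => [|a w] //=; apply: big1 => -[s|] _; by rewrite /edge /= !mul0r.
Qed.

(** A walk from s to the root has variation at least |s|, with equality only for the direct descent,
    whose label is s. *)
Lemma lead_walk0 w s :
  lead (size s) (w == s :> seq G)%:R (fun t => walk0 t w (Some s) trie_root).
Proof.
elim: w s => [|a w IH] s.
  exists 0 => // t /andP[/ltW t0 _]; rewrite mul0r /= /trie_root -[Some s == _]/(s == _).
  rewrite -val_eqE/= eq_sym; case: eqVneq => [<-|_].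
    by rewrite expr0 mulr1 subrr normr0.
  by rewrite mul0r subrr normr0.
pose v s' : R := (w == s' :> seq G)%:R * (s == a :: w :> seq G)%:R.
apply: (@eq_lead _ _ (\sum_(s' : m.-bseq G) v s') _
    (fun t => \sum_s' edge (fun=> 0) t a (Some s) (Some s') * walk0 t w (Some s') trie_root)).
- rewrite /v (big_bseq_eq w (fun=> (s == a :: w :> seq G)%:R)) eq_sym; case: eqVneq => [e|]; last by rewrite mulr0.
  have := size_bseq s; rewrite -e/= => sm; rewrite mulr1.
  by have -> : (size w <= m)%N by lia.
- by move=> t; rewrite /= big_node walk0_None mulr0 add0r.
apply: lead_sum => s' _.
have := lead_Mpow (height_dist (Some s) (Some s'))
  (edge_coef (fun=> 0) a (Some s) (Some s')) (IH s').
(* A first step down keeps the order |s|; a step up raises it, and level steps have coefficient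
   0. *)
rewrite /height_dist /=; have [ss|ss] := ltnP (size s') (size s).
  have -> : (size s - size s' + (size s' - size s) + size s' = size s)%N by lia.
  apply: eq_lead => //; rewrite /v.
  have /negPf -> : (s' : seq G) != star a :: s by apply/eqP => /(congr1 size)/=; lia.
  by rewrite orbF mulrC; case: (eqVneq w s') => [->|]; rewrite ?mul1r ?mul0r.
have -> : v s' = 0.
  rewrite /v; case: (eqVneq w s') => [->|]; last by rewrite mul0r.
  have /negPf -> : (s : seq G) != a :: s' by apply/eqP => /(congr1 size)/=; lia.
  by rewrite mulr0.
have [ss'|ss'] := eqVneq (size s) (size s').
  move=> _; apply: eq_lead (lead_0 _ _) => // t.
  by rewrite /edge edge_coef_level// !mul0r.
by apply: lead_lower; lia.
Qed.

(* The sum of [x(p^* s) y(q)] over the factorizations [w = p q] with p nonempty: the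
   walks labelled w that climb along q from the root to the extra vertex and
   descend along p to s. *)
Fixpoint two_way (x y : seq G -> R) w (s : seq G) : R :=
  if w is a :: w' then x (star a :: s) * y w' + two_way x y w' (star a :: s) else 0.

Variable x : seq G -> R.
Hypotheses (x0 : x [::] = 0) (x_big : forall w, (m.+1 < size w)%N -> x w = 0).

(** Lets the recursion be summed over words of length at most m only: longer ones contribute
    nothing. *)
Lemma two_way_big y w (s : seq G) : (m < size s)%N -> two_way x y w s = 0.
Proof.
elim: w s => //= a w IH s ms; rewrite x_big ?mul0r ?add0r; last by [].
by rewrite IH// ltnW.
Qed.

(** Subtracting the walks for x = 0 leaves those through the extra vertex. Such a walk climbs from p
    to height m + 1 and descends to the root, so its variation is at least 2 (m + 1) - h(p), with
    equality for a monotone climb and descent. *)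
Lemma lead_walk_diff w p :
  lead (2 * m.+1 - height p) (if p is Some s then two_way x x w s else x w)
    (fun t => walkx x t w p trie_root - walk0 t w p trie_root).
Proof.
elim: w p => [|a w IH] p.
  by apply: eq_lead (lead_0 _ _) => [|t]; [case: p | rewrite /= subrr].
case: p => [s|] /=.
  apply: (@eq_lead _ _ (x (star a :: s) * x w + \sum_(s' : m.-bseq G)
      (star a :: s == s' :> seq G)%:R * two_way x x w s') _
      (fun t => edge x t a (Some s) None * (walkx x t w None trie_root - walk0 t w None trie_root) +
       \sum_s' edge x t a (Some s) (Some s') *
         (walkx x t w (Some s') trie_root - walk0 t w (Some s') trie_root))).
  - rewrite (big_bseq_eq (star a :: s) (two_way x x w)) /=.
    by case: ltnP => h; rewrite ?mul1r// two_way_big ?mul0r// ltnS.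
  - move=> t; rewrite !big_node walk0_None mulr0 add0r subr0.
    rewrite -addrA -sumrB; congr (_ + _); apply: eq_bigr => s' _.
    by rewrite mulrBr.
  apply: lead_D.
    have := lead_Mpow (height_dist (Some s) None) (edge_coef x a (Some s) None) (IH None).
    rewrite /height_dist /=; have := size_bseq s => sm.
    have -> // : (size s - m.+1 + (m.+1 - size s) + (2 * m.+1 - m.+1) = 2 * m.+1 - size s)%N.
    lia.
  apply: lead_sum => s' _.
  have := lead_Mpow (height_dist (Some s) (Some s'))
    (edge_coef x a (Some s) (Some s')) (IH (Some s')).
  have sm := size_bseq s; have sm' := size_bseq s'.
  rewrite /height_dist /=; have [ss|ss] := ltnP (size s) (size s').
    have -> : (size s - size s' + (size s' - size s) + (2 * m.+1 - size s') =
      2 * m.+1 - size s)%N by lia.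
    apply: eq_lead => //.
    have /negPf -> : (s : seq G) != a :: s' by apply/eqP => /(congr1 size)/=; lia.
    by rewrite orFb eq_sym.
  (* A first step that does not climb has coefficient 0 or raises the order. *)
  have -> : (star a :: s == s' :> seq G) = false.
    by apply/eqP => /(congr1 size)/=; lia.
  rewrite mul0r; have [ss'|ss'] := eqVneq (size s) (size s').
    move=> _; apply: eq_lead (lead_0 _ _) => // t.
    by rewrite /edge edge_coef_level// !mul0r.
  by apply: lead_lower; lia.
(* After leaving the extra vertex, a walk either returns to it, at a higher order, or descends
   inside the trie, which [lead_walk0] evaluates. *)
apply: (@eq_lead _ _ (\sum_(s : m.-bseq G) 0 + \sum_(s : m.-bseq G)
      (w == s :> seq G)%:R * x (a :: s)) _
    (fun t => \sum_s edge x t a None (Some s) *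
         (walkx x t w (Some s) trie_root - walk0 t w (Some s) trie_root) +
       \sum_s edge x t a None (Some s) * walk0 t w (Some s) trie_root)).
- rewrite big1// add0r (big_bseq_eq w (fun w => x (a :: w))).
  by case: leqP => h; rewrite ?mul1r// mul0r x_big.
- move=> t; rewrite -big_split !big_node /=.
  have e y : edge y t a None None = 0 by rewrite /edge mul0r.
  rewrite !e !mul0r !add0r [X in _ = _ - X]big1 ?subr0 => [|s _].
    by apply: eq_bigr => s _; rewrite -mulrDr subrK.
  by rewrite /edge !mul0r.
apply: lead_D; apply: lead_sum => s _; have sm := size_bseq s.
  have := lead_Mpow (height_dist None (Some s)) (edge_coef x a None (Some s)) (IH (Some s)).
  by apply: lead_lower; rewrite /height_dist /=; lia.
have := lead_Mpow (height_dist None (Some s)) (edge_coef x a None (Some s)) (lead_walk0 w s).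
rewrite /height_dist /=.
have -> : (m.+1 - size s + (size s - m.+1) + size s = 2 * m.+1 - m.+1)%N by lia.
apply: eq_lead => //.
by rewrite mulrC.
Qed.

End Trie.

(** * Matrix convex implies Pythagorean *)

Section TwoWay.
Context (R : realType) (G : finType) (star : G -> G) (starK : involutive star).
Implicit Types (u v w s : seq G).

(** A factorization w = p q with p^* s = u and q = v gives w^* s = q^* p^* s = v^* u, and p is
    nonempty exactly when |s| < |u|. *)
Lemma two_way_delta u v w s :
  two_way star (fun z => (z == u)%:R : R) (fun z => (z == v)%:R) w s =
  ((size s < size u)%N && (word_star star w ++ s == word_star star v ++ u))%:R.
Proof.
elim: w s => [|a w IH] s /=.
  have [su|//] := ltnP (size s) (size u).
  have /negPf -> // : s != word_star star v ++ u.
  by apply: contraTneq su => ->; rewrite size_cat -leqNgt leq_addl.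
rewrite IH word_star_cons cat_rcons /=.
have [su|su|su] := ltngtP (size u) (size s).+1.
- have /negPf -> : (star a :: s) != u by apply/eqP => /(congr1 size)/=; lia.
  by rewrite mul0r addr0.
- have /negPf -> : (star a :: s) != u by apply/eqP => /(congr1 size)/=; lia.
  by rewrite mul0r add0r.
have [/eqP e|ne] := boolP (word_star star w ++ star a :: s == word_star star v ++ u).
  have sz : size (word_star star w) = size (word_star star v).
    by have := congr1 size e; rewrite !size_cat /=; lia.
  move: e => /eqP; rewrite eqseq_cat// => /andP[/eqP e1 /eqP e2].
  have -> : w = v by apply: (inv_inj (word_starK starK)).
  by rewrite e2 !eqxx mulr1 addr0.
rewrite addr0; case: eqVneq => [e|_]; last by rewrite mul0r.
case: eqVneq => [e'|_]; last by rewrite mulr0.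
by rewrite e e' eqxx in ne.
Qed.

Lemma two_way_sum (I : finType) (a : I -> R) (x : I -> seq G -> R) w s :
  let y z := \sum_i a i * x i z in
  two_way star y y w s = \sum_i \sum_j a i * a j * two_way star (x i) (x j) w s.
Proof.
move=> y; elim: w s => [|b w IH] s /=.
  by rewrite big1// => i _; rewrite big1// => j _; rewrite mulr0.
rewrite IH /y mulr_suml -big_split; apply: eq_bigr => i _.
rewrite mulr_sumr -big_split; apply: eq_bigr => j _ /=.
by rewrite mulrDr mulrACA.
Qed.

(** Evenness: x and -x contribute equally to the second difference. *)
Lemma two_wayN (x : seq G -> R) w s :
  two_way star (fun z => - x z) (fun z => - x z) w s = two_way star x x w s.
Proof. by elim: w s => //= a w IH s; rewrite IH mulrNN. Qed.

Lemma big_words_delta (P : pred (seq G)) m n u : (m <= size u < n)%N ->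
  \sum_(w <- words_between G m n | P w) (w == u)%:R = (P u)%:R :> R.
Proof.
move=> hu; rewrite big_mkcond (bigD1_seq u)/= ?words_between_uniq ?mem_words_between//.
rewrite eqxx big1 ?addr0 => [|w /negPf ->]; last by case: ifP.
by case: (P u).
Qed.

End TwoWay.

Lemma rdot_delta (R : realType) n (M : 'M[R[i]]_n) k :
  rdot (delta_mx k 0) (M *m delta_mx k 0) = cRe (M k k).
Proof.
rewrite rdotE (bigD1 k)//= big1 => [|i ik]; last first.
  by rewrite mxE (negPf ik) /= conjC0 mul0r.
by rewrite -colE !mxE !eqxx conjC1 mul1r addr0.
Qed.

(** * Reading off the kernel from convexity on small tuples *)

Section Converse.
Context (R : realType) (G : finType) (star : G -> G) (starK : involutive star).
Context (L : set (seq G)) (r : R) (r0 : 0 < r).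
Hypothesis convex : matrix_convex star L r.

Section TrieMatrices.
Variable m : nat.
Local Notation N := (#|{: option (m.-bseq G)}|%:R : R).
Local Notation root := (trie_root G m).

Definition trie_mx (x : seq G -> R) t := graph_mx root (edge star (m := m) x t).

Lemma trie_mx_ball (x : seq G -> R) (X t : R) : 1 <= X -> (forall w, `|x w| <= X) ->
  0 < t <= 1 -> N * (N * X) * t <= r -> nc_ball star r (trie_mx x t).
Proof.
move=> X1 xX t1 Xt; apply: (@graph_mx_ball _ _ _ _ _ _ (X * t)) (ltW r0).
- by move=> a p q; exact: edge_star.
- by move=> a p q; exact: edge_le.
- by rewrite !mulrA in Xt *.
Qed.

Lemma walk_edge_le (x : seq G -> R) (X t : R) w (p q : option (m.-bseq G)) : 1 <= X -> (forall w, `|x w| <= X) ->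
  0 < t <= 1 -> `|walk (edge star x t) w p q| <= (N * X * t) ^+ size w.
Proof. by move=> X1 xX t1; rewrite -mulrA; apply: walk_le => a p' q'; exact: edge_le. Qed.

(** Uniform convergence yields one finite F, containing the short words, that serves all x and t
    with tuple in the ball and all entries. *)
Lemma trie_mx_approx (eps : R) d : 0 < eps -> exists2 F : {fset seq G},
  (short_words G d `<=` F)%fset & forall x t, nc_ball star r (trie_mx x t) ->
  forall p q : option (m.-bseq G), normc ((\sum_(w <- F | w \in L) walk (edge star x t) w p q)%:C -
    enum_fun L (trie_mx x t) (index_of root p) (index_of root q)) <= eps.
Proof.
case: convex => _ hu _ _ e0; have [F0 _ hF] := hu _ e0.
exists (F0 `|` short_words G d)%fset; first exact: fsubsetUr.
move=> x t hx p q; have := hF (F0 `|` short_words G d)%fset (fsubsetUl _ _) _ _ hx.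
move=> /ltW; apply: le_trans; apply: le_trans (normc_entry_le _ (index_of root p) (index_of root q)).
rewrite [X in _ <= normc X]mxE [X in _ <= normc (_ + X)]mxE enum_partial_graph.
by rewrite !index_ofK.
Qed.

End TrieMatrices.

(** With x = 0 and m = |w0|, the entries of f at (w0, root) and (root, w0) have t^m coefficients
    [w0 in L] and [w0^* in L]; they agree because f is Hermitian. *)
Lemma matrix_convex_selfadjoint : selfadjoint_language star L.
Proof.
move=> w0 Lw0; pose m := size w0; pose s : m.-bseq G := Bseq (leqnn m).
pose N : R := #|{: option (m.-bseq G)}|%:R; pose z : seq G -> R := fun=> 0.
have zX w : `|z w| <= 1 by rewrite normr0.
have T0 : 0 <= N * 1 by rewrite mulr1.
have bound (p q : option (m.-bseq G)) w t : 0 < t <= 1 ->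
    `|walk (edge star z t) w p q| <= 1 * (N * 1 * t) ^+ size w.
  by move=> ht; rewrite mul1r walk_edge_le.
have [C [t1 t10 hC]] := lead_big_words (fun w => w \in L) ler01 T0
  (fun w => lead_walk0 R star w s) (bound (Some s) (trie_root G m)).
have lead' w : lead m (w == word_star star s)%:R
    (fun t => walk (edge star z t) w (trie_root G m) (Some s)).
  apply: eq_lead (lead_walk0 R star (word_star star w) s) => [|t].
    by rewrite -(inj_eq (inv_inj (word_starK starK))) word_starK.
  by rewrite (walk_star _ _ _ (edge_star starK z t)).
have [C' [t2 t20 hC']] := lead_big_words (fun w => w \in L) ler01 T0 lead'
  (bound (trie_root G m) (Some s)).
suff : 1 - (word_star star w0 \in L)%:R <= 0 :> R.
  by case: (boolP (word_star star w0 \in L)) => [/set_mem//|_]; rewrite subr0 ler10.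
pose t3 := Num.min (Num.min t1 t2) (Num.min 1 (r / (N * (N * 1) + 1))).
have N0 : 0 <= N by [].
have N1 : 0 < N * (N * 1) + 1 by rewrite mulr1 ltr_wpDl ?mulr_ge0.
apply: (@lead_le0 _ _ (C + C' + 2) t3).
  by rewrite !lt_min t10 t20 ltr01 divr_gt0.
move=> t; rewrite /t3 !le_min => /andP[tp /andP[/andP[tt1 tt2] /andP[tle1 tr]]].
have ball : nc_ball star r (trie_mx m z t).
  apply: trie_mx_ball (lexx 1) zX _ _; first by rewrite tp.
  move: tr; rewrite ler_pdivlMr// -/N mulrDr mulr1 mulrC; lra.
have tm0 : 0 < t ^+ m.+1 by rewrite exprn_gt0.
(* The approximation error t^(m+1) is one order below the leading term. *)
have [F sF hF] := trie_mx_approx m m tm0.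
have := hC t _ F sF; rewrite tp => /(_ tt1).
have := hC' t _ F sF; rewrite tp => /(_ tt2).
rewrite !big_words_delta ?size_word_star ?leqnn//.
have -> : (val s \in L) = true by exact: mem_set.
have h1 := hF z t ball (Some s) (trie_root G m).
have h2 := hF z t ball (trie_root G m) (Some s).
move: h1 h2; set S1 := \sum_(w <- F | _) _; set S2 := \sum_(w <- F | _) _.
set f1 := enum_fun _ _ _ _; set f2 := enum_fun _ _ _ _.
have f12 : f1 = Num.conj f2.
  case: convex => _ _ /(_ _ _ ball)/hermsymmxP hm _.
  by rewrite /f1 hm [LHS]mxE [in LHS]mxE.
move=> h1 h2.
have : `|S1 - S2| <= t ^+ m.+1 + t ^+ m.+1.
  rewrite -normc_real rmorphB.
  have -> : S1%:C - S2%:C = (S1%:C - f1) - Num.conj (S2%:C - f2).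
    rewrite f12 !conjCE; have -> : conjc (S2%:C - f2) = conjc S2%:C - conjc f2.
      exact: raddfB.
    by rewrite conjc_real; ring.
  apply: le_trans (normcD _ _) (lerD h1 _).
  by rewrite normcN conjCE normc_conj.
rewrite -[size s]/m -[val s]/w0 mul1r exprS !ler_norml.
have td : 0 < t ^+ m by rewrite exprn_gt0.
move: (S1) (S2) (t ^+ m) td => x1 x2 y td.
move=> /andP[_ h3] /andP[_ h4] /andP[h5 _].
by rewrite -(ler_pM2r td); lra.
Qed.

(** Convexity is applied to the tuples of x and -x, whose midpoint is the tuple of 0. The second
    difference of the root entry of f has leading order t^(2(m+1)), with coefficient twice this
    sum. *)
Lemma two_way_sum_ge0 m (x : seq G -> R) : x [::] = 0 ->
  (forall w, (m.+1 < size w)%N -> x w = 0) ->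
  0 <= \sum_(w <- words_between G 0 (2 * m.+1).+1 | w \in L) two_way star x x w [::].
Proof.
move=> x0 xbig; pose N : R := #|{: option (m.-bseq G)}|%:R.
pose y z := - x z; pose o : seq G -> R := fun=> 0.
have y0 : y [::] = 0 by rewrite /y x0 oppr0.
have ybig w : (m.+1 < size w)%N -> y w = 0 by move=> /xbig xw; rewrite /y xw oppr0.
pose X : R := 1 + \sum_(w <- words_between G 0 m.+2) `|x w|.
have X1 : 1 <= X by rewrite lerDl sumr_ge0.
have xX w : `|x w| <= X.
  have [wm|/xbig ->] := leqP (size w) m.+1; last by rewrite normr0 (le_trans ler01).
  rewrite /X (bigD1_seq w) ?words_between_uniq ?mem_words_between ?ltnS//.
  by rewrite addrCA lerDl addr_ge0// sumr_ge0.
have yX : forall w, `|y w| <= X by move=> w; rewrite normrN.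
have oX : forall w, `|o w| <= X by move=> w; rewrite normr0 (le_trans ler01).
have N0 : 0 <= N by [].
have X0 : 0 <= X := le_trans ler01 X1.
pose D (w : seq G) t := (walk (edge star x t) w (trie_root G m) (trie_root G m) -
               walk (edge star o t) w (trie_root G m) (trie_root G m)) +
              (walk (edge star y t) w (trie_root G m) (trie_root G m) -
               walk (edge star o t) w (trie_root G m) (trie_root G m)).
have leadD w : lead (2 * m.+1) (two_way star x x w [::] + two_way star x x w [::]) (D w).
  have := lead_D (lead_walk_diff star x0 xbig w (trie_root G m))
    (lead_walk_diff star y0 ybig w (trie_root G m)).
  by rewrite /= two_wayN subn0.
have bound w t : 0 < t <= 1 -> `|D w t| <= 4 * (N * X * t) ^+ size w.
  move=> ht; apply: le_trans (ler_normD _ _) _.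
  have hx := walk_edge_le w (trie_root G m) (trie_root G m) X1 xX ht.
  have hy := walk_edge_le w (trie_root G m) (trie_root G m) X1 yX ht.
  have ho := walk_edge_le w (trie_root G m) (trie_root G m) X1 oX ht.
  apply: le_trans (lerD (ler_normB _ _) (ler_normB _ _)) _.
  rewrite -/N in hx hy ho; lra.
have NX0 : 0 <= N * X by rewrite mulr_ge0.
have [C [t1 t10 hC]] := lead_big_words (fun w => w \in L) (ler0n R 4) NX0 leadD bound.
set q := \sum_(w <- _ | _) _ in hC.
have -> : \sum_(w <- words_between G 0 (2 * m.+1).+1 | w \in L) two_way star x x w [::] = q / 2.
  by rewrite /q big_split /=; field.
suff : - q <= 0 by lra.
pose t3 := Num.min t1 (Num.min 1 (r / (N * (N * X) + 1))).
have N1 : 0 < N * (N * X) + 1 by rewrite ltr_wpDl ?mulr_ge0.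
(* The second difference approximates the entries at x, -x and 0 with weights 1, 1 and 2, hence
   4. *)
apply: (@lead_le0 _ _ (C + 4) t3); first by rewrite !lt_min t10 ltr01 divr_gt0.
move=> t; rewrite /t3 !le_min => /andP[tp /andP[tt1 /andP[tle1 tr]]].
have t01 : 0 < t <= 1 by rewrite tp.
have NXt : N * (N * X) * t <= r.
  move: tr; rewrite ler_pdivlMr// mulrDr mulr1 mulrC; lra.
have ballx := trie_mx_ball X1 xX t01 NXt.
have bally := trie_mx_ball X1 yX t01 NXt.
have ballo := trie_mx_ball X1 oX t01 NXt.
have td : 0 < t ^+ (2 * m.+1) by rewrite exprn_gt0.
have e0 : 0 < t ^+ (2 * m.+1).+1 by rewrite exprn_gt0.
have [F sF hF] := trie_mx_approx m (2 * m.+1) e0.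
have := hC t _ F sF; rewrite tp => /(_ tt1).
(* Edges inside the trie do not depend on x, and those at the extra vertex cancel. *)
have mid : (fun a => 2^-1 *: (trie_mx m x t a + trie_mx m y t a)) = trie_mx m o t.
  apply/funext => a; apply/matrixP => i j; rewrite !mxE -rmorphD /edge -mulrDl.
  have -> : forall p p' : option (m.-bseq G), edge_coef star x a p p' + edge_coef star y a p p' =
      2 * edge_coef star o a p p' :> R.
    by case=> [s|] [s'|]; rewrite /y /o /= ?subrr ?addr0 ?mulr0// mulr_natl mulr2n.
  have -> : 2^-1 = (2^-1)%:C :> R[i] by rewrite fmorphV rmorph_nat.
  by rewrite -rmorphM -mulrA mulKf.
pose k := index_of (trie_root G m) (trie_root G m).
have : 0 <= cRe ((2^-1 *: (enum_fun L (trie_mx m x t) + enum_fun L (trie_mx m y t)) -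
    enum_fun L (trie_mx m o t)) k k).
  case: convex => _ _ _ /(_ _ _ _ ballx bally); rewrite mid => /psdmxP[_].
  by move=> /(_ (delta_mx k 0)); rewrite rdot_delta.
have half : 2^-1 = (2^-1)%:C :> R[i] by rewrite fmorphV rmorph_nat.
rewrite !mxE half ReD ReN Re_realM ReD.
have close z : nc_ball star r (trie_mx m z t) ->
    `|\sum_(w <- F | w \in L) walk (edge star z t) w (trie_root G m) (trie_root G m) -
      cRe (enum_fun L (trie_mx m z t) k k)| <= t ^+ (2 * m.+1).+1.
  move=> hz; apply: le_trans (hF z t hz (trie_root G m) (trie_root G m)).
  by apply: le_trans (Re_le_normc _); rewrite ReD ReN.
have := close x ballx; have := close y bally; have := close o ballo.
rewrite /D !big_split /= !sumrN !ler_norml.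
move: (\sum_(w <- F | _) walk (edge star x t) w _ _) => Sx.
move: (\sum_(w <- F | _) walk (edge star y t) w _ _) => Sy.
move: (\sum_(w <- F | _) walk (edge star o t) w _ _) => So.
move: (cRe (enum_fun L (trie_mx m x t) k k)) => fx.
move: (cRe (enum_fun L (trie_mx m y t) k k)) => fy.
move: (cRe (enum_fun L (trie_mx m o t) k k)) => fo.
rewrite exprS; move: (q) (t ^+ (2 * m.+1)) td => q' u u0.
move=> /andP[h1 h2] /andP[h3 h4] /andP[h5 h6] h7 /andP[h8 h9].
by rewrite -(ler_pM2r u0); lra.
Qed.

(** Positive semidefiniteness of K on nonempty words: x puts mass a_i at alpha_i, and [two_way] then
    places a_i a_j at the word alpha_i^* alpha_j. *)
Lemma gram_ge0 k (alpha : 'I_k -> seq G) (a : 'I_k -> R) :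
  (forall i, alpha i != [::]) ->
  0 <= \sum_i \sum_j a i * a j * (word_star star (alpha i) ++ alpha j \in L)%:R.
Proof.
move=> alpha0; pose m := \max_i size (alpha i).
pose x z : R := \sum_i a i * (z == alpha i)%:R.
have sz i : (size (alpha i) <= m)%N by exact: leq_bigmax (fun i => size (alpha i)) i.
have e w : two_way star x x w [::] = \sum_i \sum_j a i * a j *
    (w == word_star star (alpha i) ++ alpha j)%:R.
  rewrite /x (two_way_sum star a (fun i z => (z == alpha i)%:R)).
  apply: eq_bigr => i _; apply: eq_bigr => j _; rewrite two_way_delta// cats0.
  rewrite -(inj_eq (inv_inj (word_starK starK)) w) word_star_cat word_starK//.
  by rewrite lt0n size_eq0 alpha0.
have : 0 <= \sum_(w <- words_between G 0 (2 * m.+1).+1 | w \in L) two_way star x x w [::].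
  apply: two_way_sum_ge0 => [|w mw].
    by rewrite /x big1// => i _; rewrite eq_sym (negPf (alpha0 i)) mulr0.
  rewrite /x big1// => i _; case: eqVneq => [ew|_]; last by rewrite mulr0.
  by move: mw; rewrite ew ltnNge (leq_trans (sz i)).
under eq_bigr do rewrite e.
rewrite exchange_big /=; congr (_ <= _); apply: eq_bigr => i _.
rewrite exchange_big /=; apply: eq_bigr => j _.
rewrite -mulr_sumr big_words_delta// size_cat size_word_star.
by have := sz i; have := sz j; lia.
Qed.

Lemma matrix_convex_pythagorean : pythagorean star L.
Proof.
split; first exact: matrix_convex_selfadjoint.
have sL := selfadjoint_mem starK matrix_convex_selfadjoint.
move=> u v w /eqP u0 /eqP v0 /eqP w0 /mem_set vu /mem_set wu.
pose K (x y : seq G) : R := (word_star star x ++ y \in L)%:R.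
have KC x y : K x y = K y x.
  by rewrite /K -sL word_star_cat word_starK.
have K01 x y : K x y = 0 \/ K x y = 1.
  by rewrite /K; case: (_ \in L); [right | left].
have Kuv : K u v = 1 by rewrite KC /K vu.
have Kuw : K u w = 1 by rewrite KC /K wu.
have form (a b c : R) : 0 <= a ^+ 2 * K u u + b ^+ 2 * K v v + c ^+ 2 * K w w +
    2 * a * b * K u v + 2 * a * c * K u w + 2 * b * c * K v w.
  have ne (i : 'I_3) : nth [::] [:: u; v; w] i != [::] by case: i => -[|[|[|]]].
  have := gram_ge0 (fun i : 'I_3 => nth 0 [:: a; b; c] i) ne.
  rewrite !big_ord_recl !big_ord0 /= -!/(K _ _).
  by rewrite (KC v u) (KC w u) (KC w v); congr (_ <= _); ring.
have Kuu : K u u = 1.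
  (* If K(u, u) = 0, the form at (-1, 1, 0) is K(v, v) - 2 < 0. *)
  case: (K01 u u) => // uu; have := form (-1) 1 0; rewrite uu Kuv.
  by case: (K01 v v) => ->; lra.
have Kvw : K v w = 1.
  (* If K(v, w) = 0, the form at (-1, 1, 1) is K(v, v) + K(w, w) - 3 < 0. *)
  case: (K01 v w) => // vw; have := form (-1) 1 1; rewrite vw Kuu Kuv Kuw.
  by case: (K01 v v) => ->; case: (K01 w w) => ->; lra.
split.
  by apply/set_mem; move: Kuu; rewrite /K; case: (_ \in L) => // /eqP; rewrite eq_sym oner_eq0.
apply/set_mem; move: Kvw; rewrite KC /K.
by case: (_ \in L) => // /eqP; rewrite eq_sym oner_eq0.
Qed.

End Converse.

Theorem theorem2p4 (R : realType) (G : finType) (star : G -> G)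
    (star_inv : involutive star) (L : set (seq G)) :
  (exists2 r : R, 0 < r & matrix_convex star L r) <-> pythagorean star L.
Proof.
split=> [[r r0 hL]|hL]; first exact: matrix_convex_pythagorean r0 hL.
have g0 : 0 < 2 * (#|G|%:R + 1) :> R by rewrite mulr_gt0// ltr_wpDl.
(* This radius gives #|G| r <= 1/2; the 1 added to #|G| covers the empty alphabet. *)
exists (2 * (#|G|%:R + 1))^-1; first by rewrite invr_gt0.
apply: pythagorean_matrix_convex => //.
by rewrite ler_pdivrMr// mulrA mulVf// mul1r lerDl ler01.
Qed.
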